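(* Let $\alpha:J_+\to\mathbb R$ and $\beta:J_-\to\mathbb R$ be continuous, let $\eta=(\eta_-,\eta_+)$ be the associated $C^0$ input potential, let $\widehat\phi:D\to\mathbb R$ be the function produced from $\eta$ as in the context, and set $\widetilde\phi(x,y):=\widehat\phi(x,y)+\alpha(x)$ and $\check\phi(x,y):=\widetilde\phi(x,y)-\alpha(x)-\beta(y)$. Then $\check\phi:D\to\mathbb R$ is $C^{1M}$, $\widetilde\phi:D\to\mathbb R$ is $C^0$, $$\check\phi_{xy}=\sin(\check\phi+\alpha+\beta)=\check\phi_{yx},$$ and $$\widetilde\phi_{xy}=\sin\widetilde\phi=\widetilde\phi_{yx}$$ weakly, in the sense of distributions on $D$.
   Context: Let $J_+,J_-\subset\mathbb R$ be open intervals containing $0$, $D=J_+\times J_-$ with coordinates $(x,y)$, and let $\alpha:J_+\to\mathbb R$, $\beta:J_-\to\mathbb R$ be continuous. Put $$\eta_-(y)=-\tfrac{i}{2}\lambda^{-1}\begin{pmatrix}0&e^{i\beta(y)}\\ e^{-i\beta(y)}&0\end{pmatrix},\qquad \eta_+(x)=\tfrac{i}{2}\lambda\begin{pmatrix}0&e^{-i\alpha(x)}\\ e^{i\alpha(x)}&0\end{pmatrix}.$$ The loop parameter is $\lambda>0$, and everything extends holomorphically to $\lambda\in\mathbb C^*$. Let $U_+(x,\lambda)$, $U_-(y,\lambda)$ solve $\partial_xU_+=U_+\eta_+$, $U_+(0,\lambda)=I$ and $\partial_yU_-=U_-\eta_-$, $U_-(0,\lambda)=I$. A loop $g(\lambda)$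 is twisted if $g(-\lambda)=\sigma_3g(\lambda)\sigma_3^{-1}$, $\sigma_3=\mathrm{diag}(1,-1)$. By the Birkhoff decomposition theorem of Brander and Toda there is, for every $(x,y)\in D$, a unique factorization $U_-(y,\lambda)^{-1}U_+(x,\lambda)=L_+(x,y,\lambda)L_-(x,y,\lambda)^{-1}$ with $L_\pm$ twisted loops, holomorphic in $\lambda\in\mathbb C^*$ and $SU(2)$-valued for real $\lambda\ne0$, such that $L_+=L_{+_0}+\lambda L_{+_1}+\cdots$ is a power series in $\lambda$ and $L_-=I+\lambda^{-1}L_{-_{-1}}+\cdots$ is a power series in $\lambda^{-1}$; $L_\pm$ are $C^1$ in $(x,y)$. Set $\widehat U:=U_-L_+=U_+L_-$. The function $\widehat\phi:D\to\mathbb R$ is the continuous function with $\widehat\phi(0,y)=\beta(y)$ and $\widehat U^{-1}\widehat U_y=-\tfrac{i}{2}\lambda^{-1}\begin{pmatrix}0&e^{i\widehat\phi}\\ e^{-i\widehat\phi}&0\end{pmatrix}$. A $C^1$ function $g$ is $C^{1M}$ if its mixed second partials $g_{xy},g_{yx}$ exist, are continuous and are equal. *)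

(* Defs.v *)
From Stdlib Require Export Reals.
From Coquelicot Require Export Coquelicot.
Open Scope R_scope.

(** * Intervals *)

Definition open_interval (J : R -> Prop) : Prop :=
  exists a b : Rbar, forall x : R, J x <-> Rbar_lt a x /\ Rbar_lt x b.

(** * Complex 2x2 matrices *)

Definition M2 : Type := @matrix C 2 2.

(* Out of range, [ent] is [0]; quantifying a property of the entries over all
   [i j : nat] therefore only constrains the four actual entries. *)
Definition ent (A : M2) (i j : nat) : C := coeff_mat (RtoC 0) A i j.

Definition mat2 (a b c d : C) : M2 :=
  mk_matrix 2 2 (fun i j =>
    match i, j with
    | O, O => a
    | O, _ => b
    | _, O => c
    | _, _ => d
    end).

Definition mmul (A B : M2) : M2 := @Mmult C_Ring 2 2 2 A B.
Definition mid : M2 := @Mone C_Ring 2.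
Definition mscal (c : C) (A : M2) : M2 :=
  mk_matrix 2 2 (fun i j => (c * ent A i j)%C).
Definition mdet (A : M2) : C :=
  (ent A 0 0 * ent A 1 1 - ent A 0 1 * ent A 1 0)%C.
(* Cramer's formula: the inverse whenever [mdet A] is nonzero. *)
Definition minv (A : M2) : M2 :=
  mscal (/ mdet A)%C (mat2 (ent A 1 1) (- ent A 0 1) (- ent A 1 0) (ent A 0 0)).
Definition madj (A : M2) : M2 :=
  mk_matrix 2 2 (fun i j => Cconj (ent A j i)).
Definition SU2 (A : M2) : Prop := mmul A (madj A) = mid /\ mdet A = RtoC 1.
Definition sigma3 : M2 := mat2 (RtoC 1) (RtoC 0) (RtoC 0) (- RtoC 1)%C.

Definition is_mderive (F : R -> M2) (t : R) (F' : M2) : Prop :=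
  forall i j : nat,
    @is_derive R_AbsRing C_R_NormedModule (fun s => ent (F s) i j) t (ent F' i j).

(** * Potentials and frames *)

(* [expi t] is exp(i t). *)
Definition expi (t : R) : C := (cos t, sin t).

Definition offdiag (t : R) : M2 := mat2 (RtoC 0) (expi t) (expi (- t)) (RtoC 0).

Definition eta_minus (beta : R -> R) (y : R) (lam : C) : M2 :=
  mscal (- (Ci / RtoC 2) * / lam)%C (offdiag (beta y)).
Definition eta_plus (alpha : R -> R) (x : R) (lam : C) : M2 :=
  mscal (Ci / RtoC 2 * lam)%C (offdiag (- alpha x)).

(* Loops are total functions of [lam : C]; only their values on C \ {0} matter. *)
Definition is_frame (J : R -> Prop) (eta : R -> C -> M2) (U : R -> C -> M2) : Prop :=
  forall lam : C, lam <> RtoC 0 ->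
    U 0 lam = mid /\
    forall t : R, J t -> is_mderive (fun s => U s lam) t (mmul (U t lam) (eta t lam)).

(** * Loops *)

Definition twisted (g : C -> M2) : Prop :=
  forall lam : C, lam <> RtoC 0 ->
    g (- lam)%C = mmul (mmul sigma3 (g lam)) (minv sigma3).

Definition holomorphic_loop (g : C -> M2) : Prop :=
  forall lam : C, lam <> RtoC 0 ->
    forall i j : nat, @ex_derive C_AbsRing C_NormedModule (fun z => ent (g z) i j) lam.

Definition SU2_on_reals (g : C -> M2) : Prop :=
  forall r : R, r <> 0 -> SU2 (g (RtoC r)).

Definition twisted_unitary_loop (g : C -> M2) : Prop :=
  twisted g /\ holomorphic_loop g /\ SU2_on_reals g.

Definition msum_pseries (a : nat -> M2) (z : C) (S : M2) : Prop :=
  forall i j : nat,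
    @is_pseries C_AbsRing C_NormedModule (fun n => ent (a n) i j) z (ent S i j).

Definition plus_loop (g : C -> M2) : Prop :=
  exists a : nat -> M2,
    forall lam : C, lam <> RtoC 0 -> msum_pseries a lam (g lam).
Definition normalized_minus_loop (g : C -> M2) : Prop :=
  exists b : nat -> M2, b O = mid /\
    forall lam : C, lam <> RtoC 0 -> msum_pseries b (/ lam)%C (g lam).

Definition mcontinuous3 (F : R -> R -> C -> M2) (x y : R) (lam : C) : Prop :=
  forall i j : nat,
    continuous (fun p : R * R * C => ent (F (fst (fst p)) (snd (fst p)) (snd p)) i j)
      (x, y, lam).

(* C^1 as a map from D to loops, with uniform convergence on compact subsets of
   C \ {0}: such a map is C^1 exactly when its partial derivatives in x and y
   exist for every lam and are jointly continuous in (x, y, lam). *)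
Definition C1_loops (Jp Jm : R -> Prop) (F : R -> R -> C -> M2) : Prop :=
  exists Fx Fy : R -> R -> C -> M2,
    forall (x y : R) (lam : C), Jp x -> Jm y -> lam <> RtoC 0 ->
      is_mderive (fun s => F s y lam) x (Fx x y lam) /\
      is_mderive (fun s => F x s lam) y (Fy x y lam) /\
      mcontinuous3 F x y lam /\
      mcontinuous3 Fx x y lam /\
      mcontinuous3 Fy x y lam.

Definition is_birkhoff (Jp Jm : R -> Prop) (Up Um : R -> C -> M2)
    (Lp Lm : R -> R -> C -> M2) : Prop :=
  (forall x y : R, Jp x -> Jm y ->
     (forall lam : C, lam <> RtoC 0 ->
        mmul (minv (Um y lam)) (Up x lam) = mmul (Lp x y lam) (minv (Lm x y lam))) /\
     twisted_unitary_loop (Lp x y) /\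
     twisted_unitary_loop (Lm x y) /\
     plus_loop (Lp x y) /\
     normalized_minus_loop (Lm x y)) /\
  C1_loops Jp Jm Lp /\ C1_loops Jp Jm Lm.

Definition Uhat (Um : R -> C -> M2) (Lp : R -> R -> C -> M2)
    (x y : R) (lam : C) : M2 :=
  mmul (Um y lam) (Lp x y lam).

Definition is_angle (Jp Jm : R -> Prop) (beta : R -> R) (U : R -> R -> C -> M2)
    (phi : R -> R -> R) : Prop :=
  (forall x y : R, Jp x -> Jm y -> continuity_2d_pt phi x y) /\
  (forall y : R, Jm y -> phi 0 y = beta y) /\
  (forall (x y : R) (lam : C), Jp x -> Jm y -> lam <> RtoC 0 ->
     exists Uy : M2,
       is_mderive (fun s => U x s lam) y Uy /\
       mmul (minv (U x y lam)) Uy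
         = mscal (- (Ci / RtoC 2) * / lam)%C (offdiag (phi x y))).

(** * Regularity and weak derivatives of real functions on [Jp x Jm] *)

Definition Dx (f : R -> R -> R) (x y : R) : R := Derive (fun s => f s y) x.
Definition Dy (f : R -> R -> R) (x y : R) : R := Derive (fun s => f x s) y.

Definition C0_on (Jp Jm : R -> Prop) (f : R -> R -> R) : Prop :=
  forall x y : R, Jp x -> Jm y -> continuity_2d_pt f x y.

Definition C1_on (Jp Jm : R -> Prop) (f : R -> R -> R) : Prop :=
  (forall x y : R, Jp x -> Jm y ->
     ex_derive (fun s => f s y) x /\ ex_derive (fun s => f x s) y) /\
  C0_on Jp Jm f /\ C0_on Jp Jm (Dx f) /\ C0_on Jp Jm (Dy f).

(* f_xy = (f_x)_y is [Dy (Dx f)], and f_yx = (f_y)_x is [Dx (Dy f)]. *)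
Definition C1M_on (Jp Jm : R -> Prop) (f : R -> R -> R) : Prop :=
  C1_on Jp Jm f /\
  (forall x y : R, Jp x -> Jm y ->
     ex_derive (fun s => Dx f x s) y /\ ex_derive (fun s => Dy f s y) x) /\
  C0_on Jp Jm (Dy (Dx f)) /\ C0_on Jp Jm (Dx (Dy f)) /\
  (forall x y : R, Jp x -> Jm y -> Dy (Dx f) x y = Dx (Dy f) x y).

(* A compact subset of Jp x Jm lies in a compact rectangle of Jp x Jm, so these
   are the smooth functions with compact support in Jp x Jm, extended by 0,
   together with a rectangle containing the support. *)
Definition test_function (Jp Jm : R -> Prop) (a b c d : R) (psi : R -> R -> R) : Prop :=
  a <= b /\ c <= d /\
  (forall x : R, a <= x <= b -> Jp x) /\
  (forall y : R, c <= y <= d -> Jm y) /\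
  (forall (n : nat) (x y : R), ex_diff_n psi n x y) /\
  (forall x y : R, ~ (a <= x <= b /\ c <= y <= d) -> psi x y = 0).

Definition integral_rect (a b c d : R) (h : R -> R -> R) : R :=
  RInt (fun x => RInt (fun y => h x y) c d) a b.

(* For continuous [f] and [g], f_xy = g (resp. f_yx = g) as distributions on
   Jp x Jm; moving the two derivatives onto the test function reverses their
   order and produces the sign (-1)^2. *)
Definition weak_xy (Jp Jm : R -> Prop) (f g : R -> R -> R) : Prop :=
  forall (a b c d : R) (psi : R -> R -> R), test_function Jp Jm a b c d psi ->
    integral_rect a b c d (fun x y => f x y * Dx (Dy psi) x y)
    = integral_rect a b c d (fun x y => g x y * psi x y).
Definition weak_yx (Jp Jm : R -> Prop) (f g : R -> R -> R) : Prop :=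
  forall (a b c d : R) (psi : R -> R -> R), test_function Jp Jm a b c d psi ->
    integral_rect a b c d (fun x y => f x y * Dy (Dx psi) x y)
    = integral_rect a b c d (fun x y => g x y * psi x y).

(* Main.v *)
Require Import Defs.
From Stdlib Require Import ssreflect Lra Lia ZArith.

(** Write L and M for the Birkhoff factors [Lp] and [Lm] and restrict them to the circle
    lam = exp(i t). There L is a uniform limit of polynomials in lam and M a uniform limit of
    polynomials in 1/lam. Hence the mean over the circle of a product, one factor of which is an
    entry of L or of M, only sees the constant term of that entry as soon as the other factor
    has no Fourier coefficient to pair with the higher terms ([mean_hardy_mult]). This one
    computation replaces the complex analysis of loops.

    Let p, q be the diagonal constant terms of L; twistedness removes the constant term of the
    entry (0,1). Let n, m be the coefficients of 1/lam in the entries (0,1) and (1,0) of M. The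
    frame is both Um L and Up M, which gives two expressions for each of its logarithmic
    derivatives ([birkhoff_identities]). Comparing the coefficients that survive in the mean
    yields ([birkhoff_coefficients])
    - p q = 1 and exp(i phi_hat) = exp(i beta) q^2,
    - q p_x = (i/2) (exp(-i alpha) m - exp(i alpha) n),
    - m_y = -(i/2) exp(-i phi_hat) and n_y = -(i/2) exp(i phi_hat).

    The derivative of a loop with respect to x or y is only known to be continuous in lam, and
    it is never expanded in a power series: its Fourier coefficients are the derivatives of those
    of the loop, by differentiation under the integral sign, so they vanish wherever the latter
    are constant.

    With phi_check = phi_hat - beta the first line says p^2 = exp(-i phi_check), so the second
    line computes phi_check_x = -(exp(-i alpha) m - exp(i alpha) n), and the third line shows
    that this function is differentiable in y with derivative sin(phi_hat + alpha)
    ([angle_potential]). The functions alpha and beta are not differentiated anywhere.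

    As phi_check vanishes for x = 0, it is the integral of phi_check_x. Differentiating that
    integral in y gives phi_check_y = int_0^x sin(phi_hat + alpha) ds, which can be differentiated
    in x ([mixed_partials_commute]). For the weak equation, phi_tilde psi_xy - sin(phi_tilde) psi
    is the y-derivative of (phi_check + alpha) psi_x plus the x-derivative of
    beta psi_y - phi_check_y psi, and both expressions vanish on the relevant sides of the
    rectangle ([weak_of_mixed]). *)

(** * Complex-valued functions *)

(** Real and imaginary parts are separated here and in [derC] because the theorems on
    parametric integrals and the mean value theorem used below are about real functions. *)
Definition contC {T : UniformSpace} (f : T -> C) (p : T) : Prop :=
  continuous (fun q => Re (f q)) p /\ continuous (fun q => Im (f q)) p.

Definition derC (f : R -> C) (t : R) (l : C) : Prop :=
  is_derive (fun s => Re (f s)) t (Re l) /\ is_derive (fun s => Im (f s)) t (Im l).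

Lemma C_ext (a b : C) : Re a = Re b -> Im a = Im b -> a = b.
Proof. destruct a, b; simpl; intros; now f_equal. Qed.

Lemma is_derive_derC (f : R -> C) (t : R) (l : C) :
  @is_derive R_AbsRing C_R_NormedModule f t l -> derC f t l.
Proof.
  intros H; split.
  - destruct H as [_ H].
    split; [apply is_linear_scal_l|]. intros x Hx.
    intros eps. generalize (H x Hx eps). apply filter_imp. intros y Hy.
    eapply Rle_trans; [|exact Hy].
    eapply Rle_trans; [|apply (norm_le_prod_norm_1 (K:=R_AbsRing) (U:=R_NormedModule) (V:=R_NormedModule))].
    apply Req_le. reflexivity.
  - destruct H as [_ H].
    split; [apply is_linear_scal_l|]. intros x Hx.
    intros eps. generalize (H x Hx eps). apply filter_imp. intros y Hy.
    eapply Rle_trans; [|exact Hy].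
    eapply Rle_trans; [|apply (norm_le_prod_norm_2 (K:=R_AbsRing) (U:=R_NormedModule) (V:=R_NormedModule))].
    apply Req_le. reflexivity.
Qed.

Lemma continuous_contC {T : UniformSpace} (f : T -> C) (p : T) :
  continuous f p -> contC f p.
Proof.
  intros H; split.
  - apply (continuous_comp f (fst : C -> R)); [exact H|]. destruct (f p). apply continuous_fst.
  - apply (continuous_comp f (snd : C -> R)); [exact H|]. destruct (f p). apply continuous_snd.
Qed.

Lemma contC_plus {T : UniformSpace} (f g : T -> C) p : contC f p -> contC g p ->
  contC (fun q => f q + g q)%C p.
Proof. intros [a b] [c d]; split; simpl; now apply: continuous_plus. Qed.

Lemma contC_opp {T : UniformSpace} (f : T -> C) p : contC f p -> contC (fun q => - f q)%C p.
Proof. intros [a b]; split; simpl; now apply: continuous_opp. Qed.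

Lemma contC_minus {T : UniformSpace} (f g : T -> C) p : contC f p -> contC g p ->
  contC (fun q => f q - g q)%C p.
Proof. intros; apply contC_plus; [|apply contC_opp]; auto. Qed.

Lemma contC_mult {T : UniformSpace} (f g : T -> C) p : contC f p -> contC g p ->
  contC (fun q => f q * g q)%C p.
Proof.
  intros [a b] [c d]; split; simpl.
  - apply: continuous_minus; now apply (continuous_mult (K:=R_AbsRing)).
  - apply: continuous_plus; now apply (continuous_mult (K:=R_AbsRing)).
Qed.

Lemma contC_const {T : UniformSpace} (c : C) (p : T) : contC (fun _ => c) p.
Proof. split; apply continuous_const. Qed.

Lemma derC_plus f g t l m : derC f t l -> derC g t m -> derC (fun s => f s + g s)%C t (l + m)%C.
Proof. intros [a b] [c d]; split; simpl; now apply: is_derive_plus. Qed.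

Lemma derC_minus f g t l m : derC f t l -> derC g t m -> derC (fun s => f s - g s)%C t (l - m)%C.
Proof. intros [a b] [c d]; split; simpl; now apply: is_derive_minus. Qed.

Lemma derC_mult f g t l m : derC f t l -> derC g t m ->
  derC (fun s => f s * g s)%C t (l * g t + f t * m)%C.
Proof.
  intros [a b] [c d]; split; simpl.
  - evar_last. apply: is_derive_minus; apply: is_derive_mult; eauto; intros; apply Rmult_comm.
    simpl; unfold minus, plus, opp, mult; simpl; unfold Re, Im; ring.
  - evar_last. apply: is_derive_plus; apply: is_derive_mult; eauto; intros; apply Rmult_comm.
    simpl; unfold minus, plus, opp, mult; simpl; unfold Re, Im; ring.
Qed.

Lemma derC_const c t : derC (fun _ => c) t 0%C.
Proof. split; apply: is_derive_const. Qed.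

Lemma derC_scal c f t l : derC f t l -> derC (fun s => c * f s)%C t (c * l)%C.
Proof. intros H. generalize (derC_mult _ _ _ _ _ (derC_const c t) H).
 replace (0 * f t + c * l)%C with (c*l)%C by ring. auto. Qed.

Lemma derC_unique f t l m : derC f t l -> derC f t m -> l = m.
Proof.
  intros [a b] [c d]. apply C_ext.
  - now rewrite -(is_derive_unique _ _ _ a) -(is_derive_unique _ _ _ c).
  - now rewrite -(is_derive_unique _ _ _ b) -(is_derive_unique _ _ _ d).
Qed.

Lemma derC_ext_loc f g t l : locally t (fun s => f s = g s) -> derC f t l -> derC g t l.
Proof.
  intros H [a b]; split; (eapply is_derive_ext_loc; [|eassumption]);
  revert H; apply filter_imp; intros s ->; reflexivity.
Qed.

Lemma derC_contC f t l : derC f t l -> contC f t.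
Proof. intros [a b]; split; apply: ex_derive_continuous; eexists; eassumption. Qed.

(** * Fourier coefficients on the unit circle *)

(** On the circle lam = exp(i t) this is lam^k. *)
Definition ch (k : Z) (t : R) : C := expi (IZR k * t).

Lemma expi_plus a b : expi (a + b) = (expi a * expi b)%C.
Proof. unfold expi, Cmult; simpl. rewrite cos_plus sin_plus. f_equal; ring. Qed.

Lemma expi_0 : expi 0 = RtoC 1.
Proof. unfold expi. now rewrite cos_0 sin_0. Qed.

Lemma Cmod_expi a : Cmod (expi a) = 1.
Proof. unfold Cmod, expi; simpl. rewrite !Rmult_1_r.
 replace (_ + _)%R with 1. apply sqrt_1. generalize (sin2_cos2 a). unfold Rsqr. lra. Qed.

Lemma ch_plus j k t : ch (j + k) t = (ch j t * ch k t)%C.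
Proof. unfold ch. rewrite plus_IZR Rmult_plus_distr_r. apply expi_plus. Qed.

Lemma ch_0 t : ch 0 t = RtoC 1.
Proof. unfold ch. rewrite Rmult_0_l. apply expi_0. Qed.

Lemma contC_expi (f : R -> R) t : continuous f t -> contC (fun s => expi (f s)) t.
Proof.
  intros H; split; simpl.
  - apply (continuous_comp f cos); [exact H| apply continuous_cos].
  - apply (continuous_comp f sin); [exact H| apply continuous_sin].
Qed.

Lemma contC_ch k t : contC (ch k) t.
Proof. apply contC_expi. apply (continuous_scal_r (V:=R_NormedModule)). apply continuous_id. Qed.

(** The constant Fourier coefficient of a function on the circle. *)
Definition mean (f : R -> C) : C :=
  (RInt (fun t => Re (f t)) 0 (2 * PI) / (2 * PI), RInt (fun t => Im (f t)) 0 (2 * PI) / (2 * PI)).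

Lemma contC_ex_RInt (f : R -> C) a b : (forall t, contC f t) ->
  ex_RInt (fun t => Re (f t)) a b /\ ex_RInt (fun t => Im (f t)) a b.
Proof.
  intros H; split.
  - apply (ex_RInt_continuous (fun t => Re (f t))). intros z _. exact (proj1 (H z)).
  - apply (ex_RInt_continuous (fun t => Im (f t))). intros z _. exact (proj2 (H z)).
Qed.

Lemma mean_ext (f g : R -> C) : (forall t, f t = g t) -> mean f = mean g.
Proof. intros H. unfold mean. f_equal; f_equal; apply RInt_ext; intros; now rewrite H. Qed.

Lemma mean_plus (f g : R -> C) : (forall t, contC f t) -> (forall t, contC g t) ->
  mean (fun t => f t + g t)%C = (mean f + mean g)%C.
Proof.
  intros Hf Hg. destruct (contC_ex_RInt f 0 (2*PI) Hf), (contC_ex_RInt g 0 (2*PI) Hg).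
  unfold mean, Cplus; simpl.
  erewrite (RInt_ext (fun t => Re _)); [|intros; cbv [Re fst Cplus]; reflexivity].
  f_equal.
  - rewrite -Rdiv_plus_distr. f_equal. apply: RInt_plus; auto.
  - rewrite -Rdiv_plus_distr. f_equal. apply: RInt_plus; auto.
Qed.

Lemma mean_scal c (f : R -> C) : (forall t, contC f t) -> mean (fun t => c * f t)%C = (c * mean f)%C.
Proof.
  intros Hf. destruct (contC_ex_RInt f 0 (2*PI) Hf) as [H1 H2].
  assert (HP := PI_RGT_0).
  unfold mean, Cmult; simpl. f_equal.
  - evar_last. apply Rdiv_eq_compat_r. apply: (is_RInt_unique).
    apply: is_RInt_minus; apply: is_RInt_scal; apply: RInt_correct; eauto.
    unfold minus, plus, opp, scal; simpl; unfold mult; simpl. unfold Re, Im in *. field; lra.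
  - evar_last. apply Rdiv_eq_compat_r. apply: (is_RInt_unique).
    apply: is_RInt_plus; apply: is_RInt_scal; apply: RInt_correct; eauto.
    unfold minus, plus, opp, scal; simpl; unfold mult; simpl. unfold Re, Im in *. field; lra.
Qed.

Lemma mean_minus (f g : R -> C) : (forall t, contC f t) -> (forall t, contC g t) ->
  mean (fun t => f t - g t)%C = (mean f - mean g)%C.
Proof.
  intros. rewrite (mean_ext _ (fun t => f t + (-(1)) * g t)%C). 2: intros; ring.
  assert (H' : forall t, contC (fun t => - (1) * g t)%C t) by (intros; apply contC_mult;
    auto using contC_const).
  rewrite (mean_plus f (fun t => - (1) * g t)%C) // mean_scal //. ring.
Qed.

Lemma mean_const c : mean (fun _ => c) = c.
Proof. assert (HP := PI_RGT_0). unfold mean. rewrite !RInt_const. destruct c; cbv [scal]; simpl.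
  unfold mult; simpl. f_equal; field; lra. Qed.

Lemma mean_ch k : k <> 0%Z -> mean (ch k) = 0%C.
Proof.
  intros Hk. assert (HP := PI_RGT_0). assert (IZR k <> 0) by (now apply not_0_IZR).
  assert (Hs: sin (IZR k * (2*PI)) = 0).
  { replace (IZR k * (2*PI)) with (0 + 2 * IZR k * PI) by ring.
    destruct (Z_le_gt_dec 0 k) as [h|h].
    - rewrite -{1}(Z2Nat.id k h) -INR_IZR_INZ sin_period. apply sin_0.
    - replace (0 + 2 * IZR k * PI) with (- (0 + 2 * IZR (-k) * PI)) by (rewrite opp_IZR; ring).
      rewrite sin_neg -(Z2Nat.id (-k)); [|lia]. rewrite -INR_IZR_INZ sin_period sin_0. ring. }
  assert (Hc: cos (IZR k * (2*PI)) = 1).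
  { replace (IZR k * (2*PI)) with (0 + 2 * IZR k * PI) by ring.
    destruct (Z_le_gt_dec 0 k) as [h|h].
    - rewrite -{1}(Z2Nat.id k h) -INR_IZR_INZ cos_period. apply cos_0.
    - replace (0 + 2 * IZR k * PI) with (- (0 + 2 * IZR (-k) * PI)) by (rewrite opp_IZR; ring).
      rewrite cos_neg -(Z2Nat.id (-k)); [|lia]. rewrite -INR_IZR_INZ cos_period cos_0. ring. }
  unfold mean. apply C_ext; simpl.
  - erewrite is_RInt_unique. 2: {
     apply (is_RInt_derive (fun t => sin (IZR k * t) / IZR k)).
     intros; auto_derive; auto. cbv [ch expi Re fst]. field; auto.
     intros. exact (proj1 (contC_ch k _)). }
    unfold minus, plus, opp; simpl. rewrite Hs Rmult_0_r sin_0. field; lra.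
  - erewrite is_RInt_unique. 2: {
     apply (is_RInt_derive (fun t => - cos (IZR k * t) / IZR k)).
     intros; auto_derive; auto. cbv [ch expi Im snd]. field; auto.
     intros. exact (proj2 (contC_ch k _)). }
    unfold minus, plus, opp; simpl. rewrite Hc Rmult_0_r cos_0. field; lra.
Qed.

Lemma Cmod_le_sum z : Cmod z <= Rabs (Re z) + Rabs (Im z).
Proof.
  destruct z as [a b]. rewrite -(Cmod_R a) -(Cmod_R b). simpl.
  replace (a,b) with (RtoC a + Ci * RtoC b)%C by (apply C_ext; simpl; ring).
  eapply Rle_trans; [apply Cmod_triangle|]. rewrite Cmod_mult.
  replace (Cmod Ci) with 1. simpl; lra. unfold Cmod; simpl. rewrite Rmult_0_l Rplus_0_l !Rmult_1_l.
  now rewrite sqrt_1.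
Qed.

Lemma im_le_Cmod z : Rabs (Im z) <= Cmod z.
Proof. eapply Rle_trans; [apply Rmax_r|apply Rmax_Cmod]. Qed.

(** * Boundary values of power series *)

Definition trig (s : Z) (a : nat -> C) (N : nat) (t : R) : C :=
  @sum_n C_AbelianMonoid (fun n => a n * ch (s * Z.of_nat n) t)%C N.

(** Boundary values of functions that are holomorphic inside the circle ([s = 1]), with value
    [c] at 0, or outside it ([s = -1]), with value [c] at infinity. Uniform approximation by
    polynomials in lam^s with constant term [c] is all that is needed to pass to the limit
    in integrals. *)
Definition hardy (s : Z) (c : C) (f : R -> C) : Prop :=
  (forall t, contC f t) /\
  forall eps, 0 < eps -> exists (a : nat -> C) (N : nat), a O = c /\
    forall t, Cmod (f t - trig s a N t)%C <= eps.

Lemma trig_S s a N t : trig s a (S N) t = (trig s a N t + a (S N) * ch (s * Z.of_nat (S N)) t)%C.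
Proof. unfold trig. now rewrite sum_Sn. Qed.

Lemma trig_O s a t : trig s a 0 t = a O.
Proof. unfold trig. rewrite sum_O Z.mul_0_r ch_0. ring. Qed.

Lemma contC_trig s a N t : contC (trig s a N) t.
Proof.
  induction N.
  - split; (eapply continuous_ext; [intros; now rewrite trig_O|]); apply continuous_const.
  - assert (H := contC_plus _ _ _ IHN (contC_mult _ _ _ (contC_const (a (S N)) t) (contC_ch (s * Z.of_nat (S N)) t))).
    destruct H as [H1 H2].
    split; (eapply continuous_ext; [intros; now rewrite trig_S|]); auto.
Qed.

(** The dispatch is syntactic: trying to unify the closure lemmas with an arbitrary function
    would unfold the trigonometric functions. *)
Ltac contC_tac := intros; repeat lazymatch goal with
    | H : forall t, contC ?f t |- contC ?f _ => exact (H _)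
    | H : forall t, contC ?f t |- contC (fun t => ?f t) _ => exact (H _)
    | |- contC (fun t => ch _ t) _ => apply contC_ch
    | |- contC (ch _) _ => apply contC_ch
    | |- contC (trig _ _ _) _ => apply contC_trig
    | |- contC (fun t => trig _ _ _ t) _ => apply contC_trig
    | |- contC (fun t => Cplus _ _) _ => apply contC_plus
    | |- contC (fun t => Cminus _ _) _ => apply contC_minus
    | |- contC (fun t => Cmult _ _) _ => apply contC_mult
    | |- contC (fun t => Copp _) _ => apply contC_opp
    | |- contC (fun _ => ?c) _ => apply contC_const
    end.

Lemma mean_trig_mult s a N (g : R -> C) : (forall t, contC g t) ->
  (forall n, (1 <= n)%nat -> mean (fun t => ch (s * Z.of_nat n) t * g t)%C = RtoC 0) ->
  mean (fun t => trig s a N t * g t)%C = (a O * mean g)%C.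
Proof.
  intros Hg H0. induction N.
  - rewrite -mean_scal //. apply mean_ext; intros. now rewrite trig_O.
  - rewrite (mean_ext _ (fun t => trig s a N t * g t + a (S N) * (ch (s * Z.of_nat (S N)) t * g t))%C).
    2: intros; rewrite trig_S; ring.
    rewrite (mean_plus (fun t => trig s a N t * g t)%C (fun t => a (S N) * (ch (s * Z.of_nat (S N)) t * g t))%C);
      [|contC_tac|contC_tac].
    rewrite (mean_scal (a (S N)) (fun t => ch (s * Z.of_nat (S N)) t * g t)%C); [|contC_tac].
    rewrite IHN H0; [ring|lia].
Qed.

Lemma C_eq_of_small a b : (forall eps, 0 < eps -> Cmod (a - b)%C <= eps) -> a = b.
Proof.
  intros H. assert (Cmod (a - b)%C = 0).
  { apply Rle_antisym; [|apply Cmod_ge_0]. apply Rnot_lt_le. intros h.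
    specialize (H (Cmod (a-b)%C/2)). lra. }
  apply Cmod_eq_0 in H0. replace a with ((a - b) + b)%C by ring. rewrite H0. ring.
Qed.

Lemma contC_bounded (f : R -> C) a b : a <= b -> (forall t, contC f t) -> exists M, 0 < M /\
  forall t, a <= t <= b -> Cmod (f t) <= M.
Proof.
  intros Hab Hf.
  assert (Hc : forall x, continuity_pt (fun t => Rabs (Re (f t)) + Rabs (Im (f t))) x).
  { intros x. apply continuity_pt_filterlim. destruct (Hf x).
    apply (continuous_plus (K:=R_AbsRing) (V:=R_NormedModule) (fun t => Rabs (Re (f t))) (fun t => Rabs (Im (f t))));
    apply: (continuous_comp _ Rabs); auto using continuous_Rabs. }
  destruct (continuity_ab_maj (fun t => Rabs (Re (f t)) + Rabs (Im (f t))) a b Hab) as [m [Hm _]].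
  intros; apply Hc.
  exists (Rabs (Re (f m)) + Rabs (Im (f m)) + 1). split.
  generalize (Rabs_pos (Re (f m))) (Rabs_pos (Im (f m))); lra.
  intros t Ht. eapply Rle_trans; [apply Cmod_le_sum|]. specialize (Hm t Ht). lra.
Qed.

Lemma mean_bound (f : R -> C) M : (forall t, contC f t) ->
  (forall t, 0 <= t <= 2*PI -> Cmod (f t) <= M) -> Cmod (mean f) <= 2 * M.
Proof.
  intros Hf HM. destruct (contC_ex_RInt f 0 (2*PI) Hf) as [H1 H2].
  assert (HP := PI_RGT_0).
  eapply Rle_trans; [apply Cmod_le_sum|]. unfold mean; cbn [Re Im fst snd].
  assert (forall I, Rabs I <= (2*PI - 0)* M -> Rabs (I/(2*PI)) <= M).
  { intros I HI. unfold Rdiv. rewrite Rabs_mult (Rabs_pos_eq (/ _)).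
    apply (Rmult_le_reg_r (2*PI)). lra. rewrite Rmult_assoc Rinv_l; lra. left;
      apply Rinv_0_lt_compat; lra. }
  assert (H3 : Rabs (RInt (fun t : R => Re (f t)) 0 (2 * PI) / (2 * PI)) <= M).
  { apply H, abs_RInt_le_const; auto. lra. intros. eapply Rle_trans; [apply re_le_Cmod|now apply HM]. }
  assert (H4 : Rabs (RInt (fun t : R => Im (f t)) 0 (2 * PI) / (2 * PI)) <= M).
  { apply H, abs_RInt_le_const; auto. lra. intros. eapply Rle_trans; [apply im_le_Cmod|now apply HM]. }
  lra.
Qed.

(** A polynomial that approximates [f] pairs with [g] through its constant term only, since
    lam^(s n) g has mean zero for n >= 1. No series expansion of [g] is required, so [g] may be
    the derivative of a loop with respect to a parameter. *)
Lemma mean_hardy_mult s c (f g : R -> C) : hardy s c f -> (forall t, contC g t) ->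
  (forall n, (1 <= n)%nat -> mean (fun t => ch (s * Z.of_nat n) t * g t)%C = RtoC 0) ->
  mean (fun t => f t * g t)%C = (c * mean g)%C.
Proof.
  intros [Hf Ha] Hg H0. apply C_eq_of_small. intros eps Heps.
  assert (HP := PI_RGT_0).
  destruct (contC_bounded g 0 (2*PI)) as [M [HM1 HM2]]; [lra|auto|].
  destruct (Ha (eps / (2 * M))) as [a [N [Ha0 HN]]].
  { apply Rdiv_lt_0_compat; lra. }
  rewrite -Ha0 -(mean_trig_mult s a N g) //.
  rewrite -(mean_minus (fun t => f t * g t)%C (fun t => trig s a N t * g t)%C); [|contC_tac|contC_tac].
  replace eps with (2 * (eps / (2 * M) * M)) by (field; lra).
  apply mean_bound; [contC_tac|].
  intros t Ht. replace (f t * g t - trig s a N t * g t)%C with ((f t - trig s a N t) * g t)%C by ring.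
  rewrite Cmod_mult. apply Rmult_le_compat; auto using Cmod_ge_0.
Qed.

Lemma mean_hardy s c (f : R -> C) : (s <> 0)%Z -> hardy s c f -> mean f = c.
Proof.
  intros Hs H. rewrite (mean_ext f (fun t => f t * 1)%C). 2: intros; ring.
  rewrite (mean_hardy_mult s c f (fun _ => 1%C)) //. rewrite mean_const; ring.
  intros; apply contC_const.
  intros. rewrite (mean_ext _ (ch (s * Z.of_nat n))). 2: intros; ring.
  apply mean_ch. lia.
Qed.

Lemma mean_ch_hardy s c (f : R -> C) m : (s <> 0)%Z -> hardy s c f -> (1 <= m)%nat ->
  mean (fun t => ch (s * Z.of_nat m) t * f t)%C = 0%C.
Proof.
  intros Hs H Hm. rewrite (mean_ext _ (fun t => f t * ch (s * Z.of_nat m) t)%C). 2: intros; ring.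
  rewrite (mean_hardy_mult s c f) //. rewrite mean_ch. ring. lia.
  intros; apply contC_ch.
  intros. rewrite (mean_ext _ (ch (s * Z.of_nat (n + m)))).
  2: intros; rewrite -ch_plus; f_equal; lia.
  apply mean_ch. lia.
Qed.

Lemma mean_mult_hardy s c d (f g : R -> C) : (s <> 0)%Z -> hardy s c f -> hardy s d g ->
  mean (fun t => f t * g t)%C = (c * d)%C.
Proof.
  intros Hs Hf Hg. rewrite (mean_hardy_mult s c f) //. now rewrite (mean_hardy s d g). apply Hg.
  intros. now apply (mean_ch_hardy s d).
Qed.

Lemma pow_ch s n t : @pow_n C_Ring (ch s t)%C n = (ch (s * Z.of_nat n) t)%C.
Proof.
  induction n.
  - now rewrite /= Z.mul_0_r ch_0.
  - simpl pow_n. rewrite IHn. replace (s * Z.of_nat (S n))%Z with (s + s * Z.of_nat n)%Z by lia.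
    now rewrite ch_plus.
Qed.

Lemma ball_Cmod (x y : C) eps : ball (M:=C_NormedModule) x eps y -> Cmod (y - x)%C <= 2 * eps.
Proof.
  intros [H1 H2]. eapply Rle_trans; [apply Cmod_le_sum|].
  apply Rlt_le in H1; apply Rlt_le in H2.
  assert (H1' : Rabs (Re (y - x)%C) <= eps). exact H1.
  assert (H2' : Rabs (Im (y - x)%C) <= eps). exact H2. lra.
Qed.

Lemma series_terms_bound (u : nat -> C) : @ex_series C_AbsRing C_NormedModule u -> exists K,
  0 < K /\ forall n, Cmod (u n) <= K.
Proof.
  intros H. destruct H as [l Hl].
  assert (H : exists N, forall n, (N <= n)%nat -> Cmod (u (S n)) <= 4).
  { destruct (Hl _ (locally_ball l (mkposreal 1 Rlt_0_1))) as [N HN]. exists N. intros n Hn.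
    assert (h1 := ball_Cmod _ _ _ (HN n Hn)). assert (h2 := ball_Cmod _ _ _ (HN (S n) ltac:(lia))).
    rewrite sum_Sn in h2. simpl in h1, h2.
    replace (u (S n)) with ((plus (sum_n u n) (u (S n)) - l) + - (sum_n u n - l))%C
     by (cbv [plus]; simpl; ring).
    eapply Rle_trans; [apply Cmod_triangle|]. rewrite Cmod_opp.
    eapply Rle_trans; [apply Rplus_le_compat; [exact h2|exact h1]|lra]. }
  destruct H as [N HN].
  assert (H' : exists K, 0 < K /\ forall n, (n <= N)%nat -> Cmod (u n) <= K).
  { clear. induction N as [|N [K [HK IH]]].
    - exists (Cmod (u O) + 1). split. generalize (Cmod_ge_0 (u O)); lra. intros n Hn. replace n with
        O by lia. lra.
    - exists (K + Cmod (u (S N))). generalize (Cmod_ge_0 (u (S N))); intros. split; [lra|].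
      intros n Hn. destruct (Nat.eq_dec n (S N)). subst; lra. specialize (IH n ltac:(lia)); lra. }
  destruct H' as [K [HK HK']]. exists (K + 4). split; [lra|]. intros n.
  destruct (le_lt_dec n N). specialize (HK' n l0); lra.
  destruct n. lia. specialize (HN n ltac:(lia)). lra.
Qed.

(** Convergence at a point of modulus 2 bounds the coefficients by K / 2^n, and this makes the
    convergence on the circle uniform. *)
Lemma hardy_pseries s (a : nat -> C) (f : R -> C) (l2 : C) :
  @is_pseries C_AbsRing C_NormedModule a (2 * ch s 0)%C l2 ->
  (forall t, contC f t) ->
  (forall t, @is_pseries C_AbsRing C_NormedModule a (ch s t) (f t)) -> hardy s (a O) f.
Proof.
  intros H2 Hf H. split; [exact Hf|].
  assert (exists K, 0 < K /\ forall n, Cmod (a n) <= K * (1/2)^n) as [K [HK HaK]].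
  { destruct (series_terms_bound (fun n => scal (pow_n (K:=C_AbsRing) (2 * ch s 0)%C n) (a n))) as [K [HK HB]].
    eexists; exact H2. exists K; split; auto. intros n.
    specialize (HB n). revert HB. cbv [scal]; simpl. rewrite /mult /=.
    rewrite Cmod_mult.
    replace (Cmod (pow_n (K:=C_AbsRing) (2 * ch s 0)%C n)) with (2^n).
    intros HB. apply (Rmult_le_reg_l (2^n)). apply pow_lt; lra.
    eapply Rle_trans; [exact HB|]. apply Req_le.
    rewrite Rmult_comm Rmult_assoc -Rpow_mult_distr. replace (1/2*2) with 1 by field. rewrite pow1;
      ring.
    clear. induction n. simpl. unfold one; simpl. now rewrite Cmod_1.
    simpl. rewrite {1}/mult /= !Cmod_mult -IHn. unfold ch. rewrite Cmod_expi Cmod_R Rabs_pos_eq; lra. }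
  (* A telescoping form of the geometric tail estimate. *)
  assert (Htail : forall t N M, Cmod (trig s a (N + M) t - trig s a N t)%C <= K * ((1/2)^N - (1/2)^(N+M))).
  { intros t N M. induction M.
    - rewrite Nat.add_0_r. replace (_ - _)%C with (RtoC 0) by ring. rewrite Cmod_0. lra.
    - rewrite Nat.add_succ_r trig_S.
      replace (_ + _ - _)%C with ((trig s a (N+M) t - trig s a N t) + a (S (N + M)) * ch (s * Z.of_nat (S (N + M))) t)%C by ring.
      eapply Rle_trans; [apply Cmod_triangle|]. rewrite Cmod_mult. unfold ch at 1;
        rewrite Cmod_expi Rmult_1_r.
      generalize (HaK (S (N+M))). simpl. lra. }
  assert (Happ : forall t N, Cmod (f t - trig s a N t)%C <= K * (1/2)^N).
  { intros t N. apply Rnot_lt_le. intros h.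
    set (e := Cmod (f t - trig s a N t)%C - K * (1/2)^N) in *.
    assert (0 < e) by (unfold e; lra).
    assert (he : 0 < e / 2) by lra.
    destruct (H t _ (locally_ball (f t) (mkposreal _ he))) as [N' HN'].
    assert (hb := ball_Cmod _ _ _ (HN' (N + N')%nat ltac:(lia))). simpl in hb.
    replace (sum_n _ _) with (trig s a (N + N') t) in hb.
    2: { unfold trig. apply: sum_n_ext. intros. rewrite -pow_ch. rewrite /scal /= /mult /=.
    apply Cmult_comm. }
    assert (e < e); [|lra]. unfold e at 1.
    replace (f t - trig s a N t)%C with
      (- (trig s a (N+N') t - f t) + (trig s a (N+N') t - trig s a N t))%C by ring.
    eapply Rle_lt_trans. apply Rplus_le_compat_r, Cmod_triangle. rewrite Cmod_opp.
    specialize (Htail t N N'). assert (0 < K * (1/2)^(N+N')) by (apply Rmult_lt_0_compat; auto;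
      apply pow_lt; lra).
    lra. }
  intros eps Heps.
  destruct (pow_lt_1_zero (1/2)) with (y := eps / K) as [N HN].
  rewrite Rabs_pos_eq; lra. apply Rdiv_lt_0_compat; auto.
  exists a, N. split; auto. intros t. eapply Rle_trans; [apply Happ|].
  assert (0 <= (1/2)^N) by (apply pow_le; lra). specialize (HN N ltac:(lia)).
  rewrite Rabs_pos_eq // in HN.
  apply Rlt_le. apply (Rmult_lt_compat_l K) in HN; auto. replace (K * (eps/K)) with
    eps in HN by (field; lra). auto.
Qed.

Lemma mean_hardy_mult_0 s c (f g : R -> C) : hardy s c f -> (forall t, contC g t) ->
  (forall n, mean (fun t => ch (s * Z.of_nat n) t * g t)%C = 0%C) -> mean (fun t => f t * g t)%C = 0%C.
Proof.
  intros Hf Hg H. rewrite (mean_hardy_mult s c f g) //.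
  rewrite (mean_ext g (fun t => ch (s * Z.of_nat 0) t * g t)%C). rewrite H; ring.
  intros. rewrite Z.mul_0_r ch_0. ring.
Qed.

Lemma mean_ch_shift j k (g : R -> C) : mean (fun t => ch j t * (ch k t * g t))%C =
  mean (fun t => ch (j + k) t * g t)%C.
Proof. apply mean_ext; intros. rewrite ch_plus. ring. Qed.

(** The function [f] contributes its value 1 at infinity: the mean of lam^(1-n) g is zero for
    n >= 2 because only nonpositive powers occur in [g], and for n = 1 because [g] vanishes at
    infinity. *)
Lemma mean_minus_shift (f g : R -> C) : hardy (-1) 1 f -> hardy (-1) 0 g ->
  mean (fun t => f t * (ch 1 t * g t))%C = mean (fun t => ch 1 t * g t)%C.
Proof.
  intros Hf Hg. assert (contg := proj1 Hg).
  rewrite (mean_hardy_mult (-1) 1 f (fun t => ch 1 t * g t)%C) //. ring. intros; contC_tac.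
  intros n Hn. rewrite mean_ch_shift.
  destruct n as [|[|n]]; [lia| |].
  - rewrite (mean_ext _ g). now apply (mean_hardy (-1)). intros.
    rewrite (_ : (-1 * Z.of_nat 1 + 1 = 0)%Z) // ch_0; ring.
  - rewrite -(mean_ch_hardy (-1) 0 g (S n)) //; [|lia]. apply mean_ext; intros. f_equal. f_equal. lia.
Qed.

(** The mean of the (0,0) entry of the identity for the x-derivatives. On the left each entry
    of the plus factor contributes its constant term, on the right the diagonal entries of the
    minus factor do. The derivatives of the minus factor have no Fourier coefficient that could
    pair with its entries. *)
Lemma mean_x_equation (c1 c2 q : C) (L11 L01 Lx00 Lx10 M00 M01 M10 M11 Mx00 Mx10 : R -> C) :
  hardy 1 q L11 -> hardy 1 0 L01 -> (forall t, contC Lx00 t) -> (forall t, contC Lx10 t) ->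
  (forall n, (1 <= n)%nat -> mean (fun t => ch (1 * Z.of_nat n) t * Lx00 t)%C = 0%C) ->
  (forall n, (1 <= n)%nat -> mean (fun t => ch (1 * Z.of_nat n) t * Lx10 t)%C = 0%C) ->
  hardy (-1) 1 M00 -> hardy (-1) 0 M01 -> hardy (-1) 0 M10 -> hardy (-1) 1 M11 ->
  (forall t, contC Mx00 t) -> (forall t, contC Mx10 t) ->
  (forall n, mean (fun t => ch (-1 * Z.of_nat n) t * Mx00 t)%C = 0%C) ->
  (forall n, mean (fun t => ch (-1 * Z.of_nat n) t * Mx10 t)%C = 0%C) ->
  (forall t, L11 t * Lx00 t - L01 t * Lx10 t =
     c1 * (M11 t * (ch 1 t * M10 t)) - c2 * (M00 t * (ch 1 t * M01 t)) + (M11 t * Mx00 t - M01 t * Mx10 t))%C ->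
  (q * mean Lx00 = c1 * mean (fun t => ch 1 t * M10 t) - c2 * mean (fun t => ch 1 t * M01 t))%C.
Proof.
  intros H1 H2 C1 C2 V1 V2 G0 G1 G2 G3 C3 C4 V3 V4 H.
  assert (k1 := proj1 H1). assert (k2 := proj1 H2). assert (k3 := proj1 G0).
  assert (k4 := proj1 G1). assert (k5 := proj1 G2). assert (k6 := proj1 G3).
  apply mean_ext in H.
  rewrite (mean_minus (fun t => L11 t * Lx00 t)%C (fun t => L01 t * Lx10 t)%C) in H;
    [|contC_tac|contC_tac].
  rewrite (mean_plus (fun t => c1 * (M11 t * (ch 1 t * M10 t)) - c2 * (M00 t * (ch 1 t * M01 t)))%C
    (fun t => M11 t * Mx00 t - M01 t * Mx10 t)%C) in H; [|contC_tac|contC_tac].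
  rewrite (mean_minus (fun t => M11 t * Mx00 t)%C (fun t => M01 t * Mx10 t)%C) in H;
    [|contC_tac|contC_tac].
  rewrite (mean_minus (fun t => c1 * (M11 t * (ch 1 t * M10 t)))%C (fun t => c2 * (M00 t * (ch 1 t * M01 t)))%C) in H; [|contC_tac|contC_tac].
  rewrite (mean_scal c1 (fun t => M11 t * (ch 1 t * M10 t))%C) in H; [|contC_tac].
  rewrite (mean_scal c2 (fun t => M00 t * (ch 1 t * M01 t))%C) in H; [|contC_tac].
  rewrite (mean_hardy_mult 1 q L11 Lx00) // (mean_hardy_mult 1 0 L01 Lx10) // in H.
  rewrite (mean_hardy_mult_0 (-1) 1 M11 Mx00) // (mean_hardy_mult_0 (-1) 0 M01 Mx10) // in H.
  rewrite (mean_minus_shift M11 M10) // (mean_minus_shift M00 M01) // in H.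
  transitivity (q * mean Lx00 - 0 * mean Lx10)%C; [ring|]. rewrite H. ring.
Qed.

(** The mean of lam times the (0,1) entry of the identity for the y-derivatives. The terms with
    a derivative of the plus factor drop out: after multiplication by lam they contain positive
    powers of lam only. *)
Lemma mean_y_equation (k1 k2 k3 q : C) (L11 L01 Ly01 Ly11 D : R -> C) :
  hardy 1 q L11 -> hardy 1 0 L01 -> (forall t, contC Ly01 t) -> (forall t, contC Ly11 t) ->
  (forall n, (1 <= n)%nat -> mean (fun t => ch (1 * Z.of_nat n) t * Ly01 t)%C = 0%C) ->
  (forall n, (1 <= n)%nat -> mean (fun t => ch (1 * Z.of_nat n) t * Ly11 t)%C = 0%C) ->
  (forall t, contC D t) -> mean D = 1%C ->
  (forall t, k1 * (L11 t * L11 t) - k2 * (L01 t * L01 t) + (L11 t * (ch 1 t * Ly01 t) - L01 t * (ch 1 t * Ly11 t)) = k3 * D t)%C ->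
  (k1 * (q * q) = k3)%C.
Proof.
  intros H1 H2 C1 C2 V1 V2 CD HD H.
  assert (c1 := proj1 H1). assert (c2 := proj1 H2).
  apply mean_ext in H.
  rewrite (mean_plus (fun t => k1 * (L11 t * L11 t) - k2 * (L01 t * L01 t))%C
    (fun t => L11 t * (ch 1 t * Ly01 t) - L01 t * (ch 1 t * Ly11 t))%C) in H; [|contC_tac|contC_tac].
  rewrite (mean_minus (fun t => L11 t * (ch 1 t * Ly01 t))%C (fun t => L01 t * (ch 1 t * Ly11 t))%C) in H; [|contC_tac|contC_tac].
  rewrite (mean_minus (fun t => k1 * (L11 t * L11 t))%C (fun t => k2 * (L01 t * L01 t))%C) in H;
    [|contC_tac|contC_tac].
  rewrite (mean_scal k1 (fun t => L11 t * L11 t)%C) in H; [|contC_tac].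
  rewrite (mean_scal k2 (fun t => L01 t * L01 t)%C) in H; [|contC_tac].
  rewrite (mean_scal k3 D) // HD in H.
  rewrite (mean_mult_hardy 1 q q L11 L11) // (mean_mult_hardy 1 0 0 L01 L01) // in H.
  rewrite (mean_hardy_mult_0 1 q L11 (fun t => ch 1 t * Ly01 t)%C) // in H; [|contC_tac|].
  rewrite (mean_hardy_mult_0 1 0 L01 (fun t => ch 1 t * Ly11 t)%C) // in H; [|contC_tac|].
  - transitivity (k1 * (q * q) - k2 * (0 * 0) + (0 - 0))%C; [ring|]. rewrite H. ring.
  - intros n. rewrite mean_ch_shift -(V2 (S n)); [|lia]. apply mean_ext; intros. f_equal; f_equal; lia.
  - intros n. rewrite mean_ch_shift -(V1 (S n)); [|lia]. apply mean_ext; intros. f_equal; f_equal; lia.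
Qed.

Lemma mean_det_hardy s (a b c d : C) (f11 f12 f21 f22 : R -> C) : (s <> 0)%Z ->
  hardy s a f11 -> hardy s b f12 -> hardy s c f21 -> hardy s d f22 ->
  mean (fun t => f11 t * f22 t - f12 t * f21 t)%C = (a * d - b * c)%C.
Proof.
  intros Hs H1 H2 H3 H4.
  assert (c1 := proj1 H1). assert (c2 := proj1 H2).
  assert (c3 := proj1 H3). assert (c4 := proj1 H4).
  rewrite (mean_minus (fun t => f11 t * f22 t)%C (fun t => f12 t * f21 t)%C); [|contC_tac|contC_tac].
  rewrite (mean_mult_hardy s a d f11 f22) // (mean_mult_hardy s b c f12 f21) //.
Qed.

Lemma pseries_opp_arg (a : nat -> C) (z l : C) :
  @is_pseries C_AbsRing C_NormedModule a (- z)%C l ->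
  @is_pseries C_AbsRing C_NormedModule (fun n => pow_n (K:=C_Ring) (- (1))%C n * a n)%C z l.
Proof.
  intros H. apply: is_series_ext H. intros n.
  assert (E : pow_n (K:=C_Ring) (- z)%C n = (pow_n (K:=C_Ring) z n * pow_n (K:=C_Ring) (- (1))%C n)%C).
  { induction n. simpl. rewrite /one /=. ring. simpl. rewrite IHn. rewrite /mult /=. ring. }
  rewrite /scal /= /mult /=.
  change ((pow_n (K:=C_Ring) (- z)%C n * a n)%C =
    (pow_n (K:=C_Ring) z n * (pow_n (K:=C_Ring) (- (1))%C n * a n))%C).
  rewrite E. ring.
Qed.

(** * Real functions of two variables *)

Lemma open_interval_locally J x : open_interval J -> J x -> locally x J.
Proof.
  intros [a [b H]] Hx. apply H in Hx. destruct Hx as [H1 H2].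
  assert (L1 : locally x (fun y : R => Rbar_lt a y)) by now apply open_Rbar_gt.
  assert (L2 : locally x (fun y : R => Rbar_lt y b)) by now apply open_Rbar_lt.
  generalize (filter_and _ _ L1 L2). apply filter_imp. intros; now apply H.
Qed.

Lemma open_interval_between J x y z : open_interval J -> J x -> J y -> Rmin x y <= z <= Rmax x y -> J z.
Proof.
  intros [a [b H]] Hx Hy Hz. apply H in Hx. apply H in Hy. apply H.
  destruct Hx, Hy. unfold Rmin, Rmax in Hz. destruct (Rle_dec x y).
  - split. apply Rbar_lt_le_trans with x; simpl; tauto. apply Rbar_le_lt_trans with y; simpl; tauto.
  - split. apply Rbar_lt_le_trans with y; simpl; tauto. apply Rbar_le_lt_trans with x; simpl; tauto.
Qed.

Lemma continuity_2d_pt_swap h x y : continuity_2d_pt h x y -> continuity_2d_pt (fun u v => h v u) y x.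
Proof. intros H eps. destruct (H eps) as [d Hd]. exists d. intros; now apply Hd. Qed.

Lemma continuity_2d_pt_snd h x y : continuity_2d_pt h x y -> continuous (fun t => h x t) y.
Proof.
  intros H. apply continuity_pt_filterlim. apply continuity_pt_locally. intros eps.
  destruct (H eps) as [d Hd].
  exists d. intros z Hz. apply Hd; auto. rewrite Rminus_diag Rabs_R0. apply cond_pos.
Qed.

Lemma continuity_2d_pt_fst h x y : continuity_2d_pt h x y -> continuous (fun t => h t y) x.
Proof. intros H. apply (continuity_2d_pt_snd (fun u v => h v u)), continuity_2d_pt_swap, H. Qed.

Lemma continuity_2d_pt_of_fst f x y : continuous f x -> continuity_2d_pt (fun u _ => f u) x y.
Proof. intros H. apply (continuity_1d_2d_pt_comp f (fun u _ => u)).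
  now apply continuity_pt_filterlim. apply continuity_2d_pt_id1. Qed.

Lemma continuity_2d_pt_of_snd f x y : continuous f y -> continuity_2d_pt (fun _ v => f v) x y.
Proof. intros H. apply (continuity_1d_2d_pt_comp f (fun _ v => v)).
  now apply continuity_pt_filterlim. apply continuity_2d_pt_id2. Qed.

Lemma continuous_eps (f : R -> R) (x : R) : continuous f x -> forall eps : posreal,
  locally x (fun u => Rabs (f u - f x) < eps).
Proof. intros H. apply continuity_pt_locally. now apply continuity_pt_filterlim. Qed.

Lemma continuous_RInt_param (h : R -> R -> R) a b y0 :
  (forall s, Rmin a b <= s <= Rmax a b -> continuity_2d_pt h s y0) ->
  locally y0 (fun y => ex_RInt (fun s => h s y) a b) ->
  continuous (fun y => RInt (fun s => h s y) a b) y0.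
Proof.
  assert (Hab : forall a b, a <= b -> (forall s, a <= s <= b -> continuity_2d_pt h s y0) ->
  locally y0 (fun y => ex_RInt (fun s => h s y) a b) ->
  continuous (fun y => RInt (fun s => h s y) a b) y0).
  { clear a b. intros a b Hab Hc Hi.
    apply continuity_pt_filterlim, continuity_pt_locally. intros eps.
    assert (He : 0 < eps / (b - a + 1)). { apply Rdiv_lt_0_compat. apply cond_pos. lra. }
    destruct (uniform_continuity_2d_1d h a b y0 Hc (mkposreal _ He)) as [d Hd].
    generalize (filter_and _ _ Hi (locally_ball y0 d)). apply filter_imp.
    intros y [Hy Hball]. assert (Hy0 := locally_singleton _ _ Hi). simpl in Hy0.
    replace (_ - _) with (RInt (fun s => minus (h s y) (h s y0)) a b)
      by (apply: (RInt_minus (fun s => h s y) (fun s => h s y0)); auto).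
    eapply Rle_lt_trans.
    apply (abs_RInt_le_const (fun s => minus (h s y) (h s y0)) a b (eps / (b - a + 1))); auto.
    apply (ex_RInt_minus (V:=R_NormedModule)); auto.
    intros t Ht. apply Rlt_le. change (Rabs (h t y - h t y0) < mkposreal _ He).
    change (Rabs (y - y0) < d) in Hball. apply Rabs_def2 in Hball. generalize (cond_pos d); intros.
    apply Hd; auto; try lra.
    rewrite Rminus_diag Rabs_R0. apply cond_pos.
    apply Rlt_le_trans with ((b - a + 1) * (eps / (b - a + 1))).
    apply Rmult_lt_compat_r; lra. right; field; lra. }
  intros Hc Hi. destruct (Rle_dec a b) as [h0|h0].
  - apply Hab; auto. rewrite Rmin_left // Rmax_right // in Hc.
  - rewrite Rmin_right in Hc; [|lra]. rewrite Rmax_left in Hc; [|lra].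
    apply continuous_ext_loc with (fun y => opp (RInt (fun s => h s y) b a)).
    + revert Hi; apply filter_imp; intros y Hy. apply: (opp_RInt_swap (fun s => h s y)).
      now apply ex_RInt_swap.
    + apply (continuous_opp (V:=R_NormedModule)). apply Hab; auto; try lra. revert Hi; apply filter_imp.
      intros y; apply ex_RInt_swap.
Qed.

Lemma mean_value_bound (f df : R -> R) a b M : (forall z, Rmin a b <= z <= Rmax a b ->
  is_derive f z (df z)) ->
  (forall z, Rmin a b <= z <= Rmax a b -> Rabs (df z) <= M) -> Rabs (f b - f a) <= M * Rabs (b - a).
Proof.
  intros Hd HM. destruct (MVT_gen f a b df) as [c [Hc ->]].
  intros; apply Hd; lra.
  intros; apply continuity_pt_filterlim. apply: ex_derive_continuous. eexists; apply Hd; lra.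
  rewrite Rabs_mult. apply Rmult_le_compat_r; auto using Rabs_pos.
Qed.

(** A locally bounded y-derivative makes [W] Lipschitz in y, uniformly in x; continuity along
    a single horizontal line is then enough. *)
Lemma continuity_2d_of_partial (W g : R -> R -> R) x0 y0 :
  locally_2d (fun x y => is_derive (fun s => W x s) y (g x y)) x0 y0 ->
  continuity_2d_pt g x0 y0 -> continuous (fun x => W x y0) x0 -> continuity_2d_pt W x0 y0.
Proof.
  intros [d1 H1] Hg Hc eps.
  (* M bounds the y-derivative near the point. *)
  set (M := Rabs (g x0 y0) + 1). assert (HM : 0 < M) by (unfold M; generalize (Rabs_pos (g x0 y0));
    lra).
  destruct (Hg (mkposreal 1 Rlt_0_1)) as [d2 H2]. simpl in H2.
  destruct (continuous_eps _ _ Hc (pos_div_2 eps)) as [d3 H3].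
  assert (He : 0 < eps / 2 / M). { apply Rdiv_lt_0_compat; auto. apply is_pos_div_2. }
  assert (Hd : 0 < Rmin (Rmin d1 d2) (Rmin d3 (eps/2/M))).
  { repeat apply Rmin_glb_lt; auto using cond_pos. }
  exists (mkposreal _ Hd). simpl. intros u v Hu Hv.
  assert (Hm1 := Rmin_l (Rmin d1 d2) (Rmin d3 (eps/2/M))).
  assert (Hm2 := Rmin_r (Rmin d1 d2) (Rmin d3 (eps/2/M))).
  assert (Hm3 := Rmin_l d1 d2). assert (Hm4 := Rmin_r d1 d2).
  assert (Hm5 := Rmin_l d3 (eps/2/M)). assert (Hm6 := Rmin_r d3 (eps/2/M)).
  assert (A1 : Rabs (W u v - W u y0) <= M * Rabs (v - y0)).
  { apply mean_value_bound with (df := g u).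
    - intros z Hz. apply H1. lra. apply Rle_lt_trans with (Rabs (v - y0)); [|lra].
      revert Hz. unfold Rmin, Rmax, Rabs; destruct (Rle_dec y0 v), (Rcase_abs (z - y0)),
        (Rcase_abs (v - y0)); lra.
    - intros z Hz. unfold M. replace (g u z) with (g x0 y0 + (g u z - g x0 y0)) by ring.
      eapply Rle_trans; [apply Rabs_triang|]. apply Rplus_le_compat_l, Rlt_le, H2; [lra|].
      apply Rle_lt_trans with (Rabs (v - y0)); [|lra].
      revert Hz. unfold Rmin, Rmax, Rabs; destruct (Rle_dec y0 v), (Rcase_abs (z - y0)),
        (Rcase_abs (v - y0)); lra. }
  assert (A2 : Rabs (W u y0 - W x0 y0) < eps / 2) by (apply H3; change (Rabs (u - x0) < d3); lra).
  replace (W u v - W x0 y0) with ((W u v - W u y0) + (W u y0 - W x0 y0)) by ring.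
  eapply Rle_lt_trans; [apply Rabs_triang|].
  assert (M * Rabs (v - y0) <= eps / 2).
  { replace (eps/2) with (M * (eps/2/M)) by (field; lra). apply Rmult_le_compat_l; lra. }
  lra.
Qed.

(** Near [t] the angle is [phi t + asin (sin (phi s - phi t))], where continuity of [phi] keeps
    the difference in the range on which [asin] inverts [sin]. *)
Lemma derive_angle (phi : R -> R) t C' S' :
  continuous phi t -> is_derive (fun s => cos (phi s)) t C' -> is_derive (fun s => sin (phi s)) t S' ->
  is_derive phi t (S' * cos (phi t) - C' * sin (phi t)).
Proof.
  intros Hc HC HS.
  assert (Hpi := PI2_1).
  apply is_derive_ext_loc with (fun s => phi t + asin (sin (phi s) * cos (phi t) - cos (phi s) * sin (phi t))).
  - generalize (continuous_eps _ _ Hc (mkposreal 1 Rlt_0_1)). apply filter_imp. simpl. intros s Hs.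
    rewrite -sin_minus asin_sin. ring. apply Rabs_def2 in Hs. lra.
  - assert (H0 : -1 < 0 < 1) by lra.
    assert (Has : is_derive asin 0 1).
    { apply is_derive_Reals. replace 1 with (derive_pt asin 0 (derivable_pt_asin 0 H0)).
      apply derive_pt_eq_1 with (derivable_pt_asin 0 H0). reflexivity.
      rewrite derive_pt_asin. replace (1 - 0²) with 1 by (unfold Rsqr; ring). rewrite sqrt_1; field. }
    assert (Hin : is_derive (fun s => sin (phi s) * cos (phi t) - cos (phi s) * sin (phi t)) t (S' * cos (phi t) - C' * sin (phi t))).
    { apply: is_derive_minus; apply: is_derive_scal_l; auto. }
    replace (S' * cos (phi t) - C' * sin (phi t)) with
      (0 + (S' * cos (phi t) - C' * sin (phi t)) * 1) by ring.
    apply: is_derive_plus. apply: is_derive_const.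
    apply (is_derive_comp asin); auto. replace (_ - _) with 0; auto. ring.
Qed.

Lemma RInt_of_derive (f df : R -> R) a b :
  (forall x : R, Rmin a b <= x <= Rmax a b -> is_derive f x (df x)) ->
  (forall x : R, Rmin a b <= x <= Rmax a b -> continuous df x) -> RInt df a b = f b - f a.
Proof. intros H1 H2. apply is_RInt_unique. apply: is_RInt_derive; auto. Qed.

Lemma locally_2d_domain Jp Jm (P : R -> R -> Prop) x y : open_interval Jp -> open_interval Jm ->
  Jp x -> Jm y ->
  (forall u v, Jp u -> Jm v -> P u v) -> locally_2d P x y.
Proof.
  intros Hp Hm Hx Hy H. apply open_interval_locally in Hx; auto. apply open_interval_locally in Hy;
    auto.
  destruct Hx as [d1 H1], Hy as [d2 H2]. exists (mkposreal _ (Rmin_stable_in_posreal d1 d2)). simpl.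
  intros u v Hu Hv. apply H; [apply H1|apply H2].
  eapply Rlt_le_trans; [exact Hu|apply Rmin_l]. eapply Rlt_le_trans; [exact Hv|apply Rmin_r].
Qed.

(** The set [T] is a neighbourhood of every point of the interval of integration, so that the
    integrand is under control on both sides of the end points as well. *)
Lemma is_derive_RInt_Leibniz (J T : R -> Prop) (h hx : R -> R -> R) a b x :
  locally x J -> (forall t, Rmin a b <= t <= Rmax a b -> locally t T) ->
  (forall u t, J u -> T t -> is_derive (fun s => h s t) u (hx u t)) ->
  (forall u t, J u -> T t -> continuous (fun s => h u s) t) ->
  (forall t, T t -> continuity_2d_pt hx x t) ->
  is_derive (fun s => RInt (h s) a b) x (RInt (hx x) a b).
Proof.
  intros HJ HT Hd Hc Hcx.
  assert (HT' : forall t, Rmin a b <= t <= Rmax a b -> T t) by (intros; now apply locally_singleton,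
    HT).
  replace (RInt (hx x) a b) with (RInt (fun t => Derive (fun u => h u t) x) a b).
  - apply: is_derive_RInt_param.
    + revert HJ. apply filter_imp. intros u Hu t Ht. eexists; apply Hd; auto.
    + intros t Ht. apply continuity_2d_pt_ext_loc with hx; [|now apply Hcx, HT'].
      destruct HJ as [d1 H1], (HT t Ht) as [d2 H2].
      exists (mkposreal _ (Rmin_stable_in_posreal d1 d2)). simpl.
      intros u v Hu Hv. symmetry. apply is_derive_unique, Hd; [apply H1|apply H2].
      eapply Rlt_le_trans; [exact Hu|apply Rmin_l]. eapply Rlt_le_trans; [exact Hv|apply Rmin_r].
    + revert HJ. apply filter_imp. intros u Hu. apply: ex_RInt_continuous. intros; apply Hc; auto.
  - apply RInt_ext. intros t Ht. apply is_derive_unique, Hd; [|apply HT'; lra].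
    now apply locally_singleton in HJ.
Qed.

Lemma C0_on_ext (Jp Jm : R -> Prop) (h k : R -> R -> R) : open_interval Jp -> open_interval Jm ->
  (forall x y, Jp x -> Jm y -> h x y = k x y) -> C0_on Jp Jm k -> C0_on Jp Jm h.
Proof.
  intros HJp HJm Hhk Hk x y Hx Hy. apply continuity_2d_pt_ext_loc with (2 := Hk x y Hx Hy).
  apply locally_2d_domain with Jp Jm; auto. intros; symmetry; auto.
Qed.

(** * Mixed and weak derivatives *)

(** Since [f] vanishes on the axis x = 0 it is the integral of [w] in x; differentiating this
    integral in y shows that f_y exists and equals the integral [v] of [g], which has
    the x-derivative [g]. *)
Lemma mixed_partials_commute (Jp Jm : R -> Prop) (f w g : R -> R -> R) :
  open_interval Jp -> open_interval Jm -> Jp 0 ->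
  (forall x y, Jp x -> Jm y -> is_derive (fun s => f s y) x (w x y)) ->
  (forall x y, Jp x -> Jm y -> is_derive (fun s => w x s) y (g x y)) ->
  (forall x y, Jp x -> Jm y -> continuous (fun s => w s y) x) ->
  (forall x y, Jp x -> Jm y -> continuity_2d_pt g x y) ->
  (forall y, Jm y -> f 0 y = 0) ->
  let v := fun x y => RInt (fun s => g s y) 0 x in
  (forall x y, Jp x -> Jm y -> is_derive (fun s => f x s) y (v x y)) /\
  (forall x y, Jp x -> Jm y -> is_derive (fun s => v s y) x (g x y)) /\
  (forall x y, Jp x -> Jm y -> continuity_2d_pt w x y) /\
  (forall x y, Jp x -> Jm y -> continuity_2d_pt v x y).
Proof.
  intros HJp HJm H0 Hf Hw Hwc Hg Hf0 v.
  assert (Hb : forall x z, Jp x -> Rmin 0 x <= z <= Rmax 0 x -> Jp z).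
  { intros x z Hx. now apply open_interval_between. }
  assert (Hgi : forall x y, Jp x -> Jm y -> ex_RInt (fun s => g s y) 0 x).
  { intros x y Hx Hy. apply: ex_RInt_continuous. intros z Hz. apply continuity_2d_pt_fst, Hg; eauto. }
  assert (Hwc2 : forall x y, Jp x -> Jm y -> continuity_2d_pt w x y).
  { intros x y Hx Hy. apply continuity_2d_of_partial with g; auto.
    apply locally_2d_domain with Jp Jm; auto. }
  assert (Hvx : forall x y, Jp x -> Jm y -> is_derive (fun s => v s y) x (g x y)).
  { intros x y Hx Hy. apply (is_derive_RInt (fun s => g s y) (fun x => v x y) 0 x).
    - generalize (open_interval_locally _ _ HJp Hx). apply filter_imp.
      intros z Hz. apply: RInt_correct. auto.
    - apply continuity_2d_pt_fst; auto. }
  split; [|split; [exact Hvx|split; [exact Hwc2|]]].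
  - intros x y Hx Hy.
    apply is_derive_ext_loc with (fun y => RInt (fun s => w s y) 0 x).
    + generalize (open_interval_locally _ _ HJm Hy). apply filter_imp. intros z Hz.
      rewrite (RInt_of_derive (fun s => f s z)).
      rewrite Hf0; auto; apply Rminus_0_r.
      intros; apply Hf; eauto. intros; apply Hwc; eauto.
    + apply (is_derive_RInt_Leibniz Jm Jp (fun y s => w s y) (fun y s => g s y)).
      * now apply open_interval_locally.
      * intros t Ht. apply open_interval_locally; eauto.
      * intros; now apply Hw.
      * intros; now apply Hwc.
      * intros; now apply continuity_2d_pt_swap, Hg.
  - intros x y Hx Hy.
    apply (continuity_2d_pt_swap (fun y x => v x y)).
    apply continuity_2d_of_partial with (fun y x => g x y).
    + apply locally_2d_domain with Jm Jp; auto.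
    + now apply continuity_2d_pt_swap, Hg.
    + apply continuous_RInt_param. intros; apply Hg; eauto.
      generalize (open_interval_locally _ _ HJm Hy). apply filter_imp. intros; auto.
Qed.

Lemma C1M_of_mixed (Jp Jm : R -> Prop) (f w v g : R -> R -> R) :
  open_interval Jp -> open_interval Jm ->
  (forall x y, Jp x -> Jm y -> is_derive (fun s => f s y) x (w x y)) ->
  (forall x y, Jp x -> Jm y -> is_derive (fun s => f x s) y (v x y)) ->
  (forall x y, Jp x -> Jm y -> is_derive (fun s => w x s) y (g x y)) ->
  (forall x y, Jp x -> Jm y -> is_derive (fun s => v s y) x (g x y)) ->
  C0_on Jp Jm f -> C0_on Jp Jm w -> C0_on Jp Jm v -> C0_on Jp Jm g ->
  C1M_on Jp Jm f /\ (forall x y, Jp x -> Jm y -> Dy (Dx f) x y = g x y /\ Dx (Dy f) x y = g x y).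
Proof.
  intros HJp HJm Hfx Hfy Hwy Hvx Cf Cw Cv Cg.
  assert (E1 : forall x y, Jp x -> Jm y -> Dx f x y = w x y) by (intros; now apply is_derive_unique,
    Hfx).
  assert (E2 : forall x y, Jp x -> Jm y -> Dy f x y = v x y) by (intros; now apply is_derive_unique,
    Hfy).
  assert (H1 : forall x y, Jp x -> Jm y -> is_derive (fun s => Dx f x s) y (g x y)).
  { intros x y Hx Hy. apply is_derive_ext_loc with (2 := Hwy x y Hx Hy).
    generalize (open_interval_locally _ _ HJm Hy). apply filter_imp. intros; now rewrite E1. }
  assert (H2 : forall x y, Jp x -> Jm y -> is_derive (fun s => Dy f s y) x (g x y)).
  { intros x y Hx Hy. apply is_derive_ext_loc with (2 := Hvx x y Hx Hy).
    generalize (open_interval_locally _ _ HJp Hx). apply filter_imp. intros; now rewrite E2. }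
  assert (E3 : forall x y, Jp x -> Jm y -> Dy (Dx f) x y = g x y) by (intros;
    now apply is_derive_unique, H1).
  assert (E4 : forall x y, Jp x -> Jm y -> Dx (Dy f) x y = g x y) by (intros;
    now apply is_derive_unique, H2).
  assert (Hext := fun h k => C0_on_ext Jp Jm h k HJp HJm).
  split; [|now auto].
  split; [split|].
  - intros x y Hx Hy. split; eexists; eauto.
  - eauto.
  - split; [|split; [|split]]; eauto.
    + intros x y Hx Hy. split; eexists; eauto.
    + intros. rewrite E3 // E4 //.
Qed.

(** The function [psi] vanishes outside the rectangle, hence on its sides by continuity, and so
    do its derivatives along the sides. *)
Lemma test_function_facts Jp Jm a b c d psi : test_function Jp Jm a b c d psi ->
  (forall x y, is_derive (fun s => psi s y) x (Dx psi x y)) /\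
  (forall x y, is_derive (fun s => psi x s) y (Dy psi x y)) /\
  (forall x y, is_derive (fun s => Dx psi x s) y (Dy (Dx psi) x y)) /\
  (forall x y, is_derive (fun s => Dy psi s y) x (Dx (Dy psi) x y)) /\
  (forall x y, continuity_2d_pt psi x y) /\
  (forall x y, continuity_2d_pt (Dx psi) x y) /\
  (forall x y, continuity_2d_pt (Dy psi) x y) /\
  (forall x y, continuity_2d_pt (Dy (Dx psi)) x y) /\
  (forall x y, Dx (Dy psi) x y = Dy (Dx psi) x y) /\
  (forall y, psi a y = 0 /\ psi b y = 0 /\ Dy psi a y = 0 /\ Dy psi b y = 0) /\
  (forall x, Dx psi x c = 0 /\ Dx psi x d = 0).
Proof.
  intros [Hab [Hcd [_ [_ [Hd H0]]]]].
  assert (D1 : forall x y, ex_derive (fun s => psi s y) x).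
  { intros x y. destruct (Hd 1%nat x y) as [_ [h _]]. exact h. }
  assert (D2 : forall x y, ex_derive (fun s => psi x s) y).
  { intros x y. destruct (Hd 1%nat x y) as [_ [_ [h _]]]. exact h. }
  assert (D3 : forall x y, ex_derive (fun s => Dx psi x s) y).
  { intros x y. destruct (Hd 2%nat x y) as [_ [_ [_ [[_ [_ [h _]]] _]]]]. exact h. }
  assert (D4 : forall x y, ex_derive (fun s => Dy psi s y) x).
  { intros x y. destruct (Hd 2%nat x y) as [_ [_ [_ [_ [_ [h _]]]]]]. exact h. }
  assert (K0 : forall x y, continuity_2d_pt psi x y).
  { intros x y. destruct (Hd 0%nat x y) as [h _]. exact h. }
  assert (K1 : forall x y, continuity_2d_pt (Dx psi) x y).
  { intros x y. destruct (Hd 1%nat x y) as [_ [_ [_ [[h _] _]]]]. exact h. }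
  assert (K2 : forall x y, continuity_2d_pt (Dy psi) x y).
  { intros x y. destruct (Hd 1%nat x y) as [_ [_ [_ [_ [h _]]]]]. exact h. }
  assert (K3 : forall x y, continuity_2d_pt (Dy (Dx psi)) x y).
  { intros x y. destruct (Hd 2%nat x y) as [_ [_ [_ [[_ [_ [_ [_ [h _]]]]] _]]]]. exact h. }
  assert (K4 : forall x y, continuity_2d_pt (Dx (Dy psi)) x y).
  { intros x y. destruct (Hd 2%nat x y) as [_ [_ [_ [_ [_ [_ [_ [[h _] _]]]]]]]]. exact h. }
  assert (Hl : forall h : R -> R, forall z, continuous h z -> (forall s, s < z -> h s = 0) -> h z = 0).
  { intros h z Hc Hz. apply Rminus_diag_uniq_sym. apply Rminus_diag_eq. symmetry.
    destruct (Req_dec (h z) 0) as [e|e]; auto. exfalso.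
    assert (He : 0 < Rabs (h z)) by now apply Rabs_pos_lt.
    destruct (continuous_eps h z Hc (mkposreal _ He)) as [dl Hdl]. simpl in Hdl.
    assert (Hp := cond_pos dl).
    specialize (Hdl (z - dl / 2)). rewrite Hz in Hdl; [|lra].
    rewrite Rminus_0_l Rabs_Ropp in Hdl. apply (Rlt_irrefl (Rabs (h z))), Hdl.
    change (Rabs (z - dl / 2 - z) < dl). replace (z - dl/2 - z) with (-(dl/2)) by ring.
    rewrite Rabs_Ropp Rabs_pos_eq; lra. }
  assert (Hr : forall h : R -> R, forall z, continuous h z -> (forall s, z < s -> h s = 0) -> h z = 0).
  { intros h z Hc Hz. rewrite -(Ropp_involutive z). apply (Hl (fun s => h (- s))).
    apply continuous_comp. apply (continuous_opp (V:=R_NormedModule)), continuous_id.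
    rewrite Ropp_involutive; exact Hc. intros; apply Hz; lra. }
  assert (Ba : forall y, psi a y = 0).
  { intros y. apply (Hl (fun s => psi s y)). apply continuity_2d_pt_fst, K0. intros; apply H0; lra. }
  assert (Bb : forall y, psi b y = 0).
  { intros y. apply (Hr (fun s => psi s y)). apply continuity_2d_pt_fst, K0. intros; apply H0; lra. }
  assert (Bc : forall x, psi x c = 0).
  { intros x. apply (Hl (fun s => psi x s)). apply continuity_2d_pt_snd, K0. intros; apply H0; lra. }
  assert (Bd : forall x, psi x d = 0).
  { intros x. apply (Hr (fun s => psi x s)). apply continuity_2d_pt_snd, K0. intros; apply H0; lra. }
  assert (Z : forall h, (forall t, h t = 0) -> forall z, Derive h z = 0).
  { intros h Hh z. rewrite (Derive_ext _ (fun _ => 0)) //. apply Derive_const. }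
  split; [intros; now apply Derive_correct|].
  split; [intros; now apply Derive_correct|].
  split; [intros; now apply Derive_correct|].
  split; [intros; now apply Derive_correct|].
  split; [exact K0|]. split; [exact K1|]. split; [exact K2|]. split; [exact K3|].
  split; [|split].
  - intros x y. apply Schwarz; [|apply K4|apply K3].
    exists (mkposreal 1 Rlt_0_1). intros u v _ _.
    split; [apply D1|split; [apply D2|split; [apply (D4 u v)|apply (D3 u v)]]].
  - intros y. split; [apply Ba|split; [apply Bb|split; now apply Z]].
  - intros x. split; now apply Z.
Qed.

Lemma integral_rect_ext a b c d h k : a <= b -> c <= d ->
  (forall x y, a <= x <= b -> c <= y <= d -> h x y = k x y) -> integral_rect a b c d h =
    integral_rect a b c d k.
Proof.
  intros Hab Hcd H. apply RInt_ext. rewrite Rmin_left // Rmax_right //. intros x Hx.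
  apply RInt_ext. rewrite Rmin_left // Rmax_right //. intros; apply H; lra.
Qed.

Ltac continuity_2d_tac := repeat first [apply continuity_2d_pt_minus | apply continuity_2d_pt_plus | apply continuity_2d_pt_mult].

(** The inner integral of [Fy] is a difference of boundary values, and the inner integral of
    [Gx] is the x-derivative of the inner integral of [G]. The order of integration is never
    exchanged. *)
Lemma integral_rect_divergence (Jp Jm : R -> Prop) (F Fy G Gx : R -> R -> R) a b c d :
  open_interval Jp -> open_interval Jm -> a <= b -> c <= d ->
  (forall x, a <= x <= b -> Jp x) -> (forall y, c <= y <= d -> Jm y) ->
  (forall x y, Jp x -> Jm y -> is_derive (fun s => F x s) y (Fy x y)) ->
  (forall x y, Jp x -> Jm y -> is_derive (fun s => G s y) x (Gx x y)) ->
  C0_on Jp Jm Fy -> C0_on Jp Jm Gx -> C0_on Jp Jm G ->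
  (forall x, F x c = 0 /\ F x d = 0) -> (forall y, G a y = 0 /\ G b y = 0) ->
  integral_rect a b c d (fun x y => Fy x y + Gx x y) = 0.
Proof.
  intros HJp HJm Hab Hcd Ha Hc HF HG CF CGx CG BF BG.
  assert (Hc' : forall y, Rmin c d <= y <= Rmax c d -> Jm y) by (rewrite Rmin_left // Rmax_right //).
  assert (Ha' : forall y, Rmin a b <= y <= Rmax a b -> Jp y) by (rewrite Rmin_left // Rmax_right //).
  unfold integral_rect.
  rewrite (RInt_ext _ (fun x => RInt (Gx x) c d)).
  - rewrite (RInt_of_derive (fun x => RInt (G x) c d)).
    + rewrite (RInt_ext (G b) (fun _ => 0)). 2: intros; apply BG.
      rewrite (RInt_ext (G a) (fun _ => 0)). 2: intros; apply BG. apply Rminus_diag.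
    + intros x Hx. apply (is_derive_RInt_Leibniz Jp Jm).
      * apply open_interval_locally; auto.
      * intros t Ht. apply open_interval_locally; auto.
      * auto.
      * intros; now apply continuity_2d_pt_snd, CG.
      * intros; apply CGx; auto.
    + intros x Hx. apply (continuous_RInt_param (fun s x => Gx x s)).
      * intros; apply continuity_2d_pt_swap, CGx; auto.
      * generalize (open_interval_locally _ _ HJp (Ha' _ Hx)). apply filter_imp. intros z Hz.
        apply: ex_RInt_continuous. intros; apply continuity_2d_pt_snd, CGx; auto.
  - intros x Hx.
    assert (Hx' : Jp x) by (apply Ha'; lra).
    etransitivity. apply: (RInt_plus (Fy x) (Gx x)).
    + apply: ex_RInt_continuous. intros; apply continuity_2d_pt_snd, CF; auto.
    + apply: ex_RInt_continuous. intros; apply continuity_2d_pt_snd, CGx; auto.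
    + rewrite (RInt_of_derive (F x) (Fy x)).
      * destruct (BF x) as [-> ->]. unfold plus; simpl. ring.
      * intros; apply HF; auto.
      * intros; apply continuity_2d_pt_snd, CF; auto.
Qed.

Lemma integral_rect_minus (Jp Jm : R -> Prop) h k a b c d :
  open_interval Jp -> open_interval Jm -> a <= b -> c <= d ->
  (forall x, a <= x <= b -> Jp x) -> (forall y, c <= y <= d -> Jm y) ->
  C0_on Jp Jm h -> C0_on Jp Jm k ->
  integral_rect a b c d (fun x y => h x y - k x y) = integral_rect a b c d h - integral_rect a b c d k.
Proof.
  intros HJp HJm Hab Hcd Ha Hc Ch Ck.
  assert (Hc' : forall y, Rmin c d <= y <= Rmax c d -> Jm y) by (rewrite Rmin_left // Rmax_right //).
  assert (Ha' : forall y, Rmin a b <= y <= Rmax a b -> Jp y) by (rewrite Rmin_left // Rmax_right //).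
  assert (I1 : forall h x, C0_on Jp Jm h -> Jp x -> ex_RInt (h x) c d).
  { intros h' x C Hx. apply: ex_RInt_continuous. intros; apply continuity_2d_pt_snd, C; auto. }
  assert (I2 : forall h, C0_on Jp Jm h -> ex_RInt (fun x => RInt (h x) c d) a b).
  { intros h' C. apply: ex_RInt_continuous. intros x Hx.
    apply (continuous_RInt_param (fun s x => h' x s)).
      * intros; apply continuity_2d_pt_swap, C; auto.
      * generalize (open_interval_locally _ _ HJp (Ha' _ Hx)). apply filter_imp. auto. }
  unfold integral_rect.
  etransitivity; [|apply: (RInt_minus (fun x => RInt (h x) c d) (fun x => RInt (k x) c d)); auto].
  apply RInt_ext. intros x Hx. apply: (RInt_minus (h x) (k x)); apply I1; auto; apply Ha'; lra.
Qed.

(** The difference of the two integrands is the y-derivative of (f + alpha) psi_x plus the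
    x-derivative of beta psi_y - v psi. In this splitting [alpha] sits under a y-derivative and
    [beta] under an x-derivative, so both behave as constants. *)
Lemma weak_of_mixed (Jp Jm : R -> Prop) (f v g : R -> R -> R) (alpha beta : R -> R) :
  open_interval Jp -> open_interval Jm ->
  (forall x y, Jp x -> Jm y -> is_derive (fun s => f x s) y (v x y)) ->
  (forall x y, Jp x -> Jm y -> is_derive (fun s => v s y) x (g x y)) ->
  C0_on Jp Jm f -> C0_on Jp Jm v -> C0_on Jp Jm g ->
  (forall x, Jp x -> continuous alpha x) -> (forall y, Jm y -> continuous beta y) ->
  forall a b c d psi, test_function Jp Jm a b c d psi ->
  integral_rect a b c d (fun x y => (f x y + alpha x + beta y) * Dy (Dx psi) x y)
   = integral_rect a b c d (fun x y => g x y * psi x y).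
Proof.
  intros HJp HJm Hf Hv Cf Cv Cg Ca Cb a b c d psi Hpsi.
  destruct (test_function_facts _ _ _ _ _ _ _ Hpsi) as [P1 [P2 [P3 [P4 [K0 [K1 [K2 [K3 [S [B1 B2]]]]]]]]]].
  destruct Hpsi as [Hab [Hcd [Ha [Hc _]]]].
  assert (Ca' : C0_on Jp Jm (fun x _ => alpha x)) by (intros x y Hx Hy;
    now apply continuity_2d_pt_of_fst, Ca).
  assert (Cb' : C0_on Jp Jm (fun _ y => beta y)) by (intros x y Hx Hy;
    now apply continuity_2d_pt_of_snd, Cb).
  (* Both integrals are merged into the integral of a divergence. *)
  unfold C0_on in *. apply Rminus_diag_uniq.
  rewrite -(integral_rect_minus Jp Jm) //.
  2, 3: intros x y Hx Hy; continuity_2d_tac; auto.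
  rewrite -(integral_rect_divergence Jp Jm
    (fun x y => (f x y + alpha x) * Dx psi x y)
    (fun x y => v x y * Dx psi x y + (f x y + alpha x) * Dy (Dx psi) x y)
    (fun x y => beta y * Dy psi x y - v x y * psi x y)
    (fun x y => beta y * Dy (Dx psi) x y - (g x y * psi x y + v x y * Dx psi x y)) a b c d) //.
  - apply integral_rect_ext; auto. intros; ring.
  - intros x y Hx Hy.
    apply (is_derive_mult (fun s => f x s + alpha x) (Dx psi x) y (v x y) (Dy (Dx psi) x y)); auto.
    2: intros; apply Rmult_comm.
    rewrite -(Rplus_0_r (v x y)). apply: is_derive_plus; auto. apply: is_derive_const.
  - intros x y Hx Hy. apply: is_derive_minus.
    + rewrite -S. apply: is_derive_scal. auto.
    + apply (is_derive_mult (fun s => v s y) (fun s => psi s y) x (g x y) (Dx psi x y)); auto.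
      intros; apply Rmult_comm.
  - intros x y Hx Hy; continuity_2d_tac; auto.
  - intros x y Hx Hy; continuity_2d_tac; auto.
  - intros x y Hx Hy; continuity_2d_tac; auto.
  - intros x. destruct (B2 x) as [-> ->]. split; ring.
  - intros y. destruct (B1 y) as [-> [-> [-> ->]]]. split; ring.
Qed.

(** * Matrix-valued functions and frames *)

Lemma M2_ext (A B : M2) : (forall i j, (i < 2)%nat -> (j < 2)%nat -> ent A i j = ent B i j) -> A = B.
Proof. intros H. apply (coeff_mat_ext_aux (RtoC 0) (RtoC 0)). exact H. Qed.

Lemma ent_mk (f : nat -> nat -> C) i j : (i < 2)%nat -> (j < 2)%nat -> ent (mk_matrix 2 2 f) i j =
  f i j.
Proof. intros; unfold ent; now apply coeff_mat_bij. Qed.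

Lemma ent_mmul A B i j : (i < 2)%nat -> (j < 2)%nat ->
  ent (mmul A B) i j = (ent A i 0 * ent B 0 j + ent A i 1 * ent B 1 j)%C.
Proof.
  intros Hi Hj. unfold mmul, Mmult. rewrite ent_mk //. rewrite sum_Sn sum_O. reflexivity.
Qed.

Lemma ent_mscal c A i j : (i < 2)%nat -> (j < 2)%nat -> ent (mscal c A) i j = (c * ent A i j)%C.
Proof. intros; unfold mscal; now rewrite ent_mk. Qed.

(** The adjugate. With it in place of [minv] the determinants of the Birkhoff factors, which are
    known to be 1 only for real lam, appear as explicit factors in the identities. *)
Definition cof (A : M2) : M2 := mat2 (ent A 1 1) (- ent A 0 1)%C (- ent A 1 0)%C (ent A 0 0).

Definition madd (A B : M2) : M2 := mk_matrix 2 2 (fun i j => (ent A i j + ent B i j)%C).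

Lemma ent_madd A B i j : (i < 2)%nat -> (j < 2)%nat -> ent (madd A B) i j = (ent A i j + ent B i j)%C.
Proof. intros; unfold madd; now rewrite ent_mk. Qed.

Lemma ent_mid : ent mid 0 0 = 1%C /\ ent mid 0 1 = 0%C /\ ent mid 1 0 = 0%C /\ ent mid 1 1 = 1%C.
Proof. repeat split; reflexivity. Qed.

Lemma ent_mat2_00 a b c d : ent (mat2 a b c d) 0 0 = a. Proof. reflexivity. Qed.

Lemma ent_mat2_01 a b c d : ent (mat2 a b c d) 0 1 = b. Proof. reflexivity. Qed.

Lemma ent_mat2_10 a b c d : ent (mat2 a b c d) 1 0 = c. Proof. reflexivity. Qed.

Lemma ent_mat2_11 a b c d : ent (mat2 a b c d) 1 1 = d. Proof. reflexivity. Qed.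

Ltac C_ring_tac := match goal with |- @eq _ ?a ?b => change (@eq C a b) end; ring.

Ltac entries_tac := repeat match goal with
  | |- context [ent (mmul ?A ?B) ?i ?j] => rewrite (ent_mmul A B i j); [|lia|lia]
  | |- context [ent (mscal ?c ?A) ?i ?j] => rewrite (ent_mscal c A i j); [|lia|lia]
  | |- context [ent (madd ?A ?B) ?i ?j] => rewrite (ent_madd A B i j); [|lia|lia]
  | |- context [ent (mat2 ?a ?b ?c ?d) 0 0] => rewrite (ent_mat2_00 a b c d)
  | |- context [ent (mat2 ?a ?b ?c ?d) 0 1] => rewrite (ent_mat2_01 a b c d)
  | |- context [ent (mat2 ?a ?b ?c ?d) 1 0] => rewrite (ent_mat2_10 a b c d)
  | |- context [ent (mat2 ?a ?b ?c ?d) 1 1] => rewrite (ent_mat2_11 a b c d)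
  end.

Ltac matrix_tac := apply M2_ext; intros i j Hi Hj; (destruct i as [|[|i]]; [| |lia]);
  (destruct j as [|[|j]]; [| |lia]); clear Hi Hj; unfold cof, mdet, minv; entries_tac.

Lemma mmul_assoc A B D : mmul A (mmul B D) = mmul (mmul A B) D.
Proof. matrix_tac; C_ring_tac. Qed.

Lemma mmul_madd A B D : mmul A (madd B D) = madd (mmul A B) (mmul A D).
Proof. matrix_tac; C_ring_tac. Qed.

Lemma mmul_mscal c A B : mmul A (mscal c B) = mscal c (mmul A B).
Proof. matrix_tac; C_ring_tac. Qed.

Lemma mscal_mmul c A B : mmul (mscal c A) B = mscal c (mmul A B).
Proof. matrix_tac; C_ring_tac. Qed.

Lemma cof_mul A B : cof (mmul A B) = mmul (cof B) (cof A).
Proof. matrix_tac; C_ring_tac. Qed.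

Lemma cof_l A : mmul (cof A) A = mscal (mdet A) mid.
Proof. destruct ent_mid as [E1 [E2 [E3 E4]]]. matrix_tac; rewrite ?E1 ?E2 ?E3 ?E4; C_ring_tac. Qed.

Lemma cof_r A : mmul A (cof A) = mscal (mdet A) mid.
Proof. destruct ent_mid as [E1 [E2 [E3 E4]]]. matrix_tac; rewrite ?E1 ?E2 ?E3 ?E4; C_ring_tac. Qed.

Lemma mmul_1_l A : mmul mid A = A.
Proof. destruct ent_mid as [E1 [E2 [E3 E4]]]. matrix_tac; rewrite ?E1 ?E2 ?E3 ?E4; C_ring_tac. Qed.

Lemma mmul_1_r A : mmul A mid = A.
Proof. destruct ent_mid as [E1 [E2 [E3 E4]]]. matrix_tac; rewrite ?E1 ?E2 ?E3 ?E4; C_ring_tac. Qed.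

Lemma mscal_1 A : mscal 1 A = A.
Proof. matrix_tac; C_ring_tac. Qed.

Lemma mscal_mscal a b A : mscal a (mscal b A) = mscal (a * b) A.
Proof. matrix_tac; C_ring_tac. Qed.

Lemma mdet_mmul A B : mdet (mmul A B) = (mdet A * mdet B)%C.
Proof. unfold mdet. entries_tac. C_ring_tac. Qed.

Lemma mdet_mid : mdet mid = 1%C.
Proof. destruct ent_mid as [E1 [E2 [E3 E4]]]. unfold mdet. rewrite E1 E2 E3 E4. C_ring_tac. Qed.

Lemma minv_cof A : minv A = mscal (/ mdet A) (cof A).
Proof. reflexivity. Qed.

Lemma mdet_minv A : mdet (minv A) = (/ mdet A * / mdet A * mdet A)%C.
Proof. unfold minv, mdet at 1. entries_tac. unfold mdet. C_ring_tac. Qed.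

Lemma minv_r A : mdet A <> 0%C -> mmul A (minv A) = mid.
Proof. intros H. rewrite minv_cof mmul_mscal cof_r mscal_mscal Cinv_l // mscal_1 //. Qed.

Lemma minv_l A : mdet A <> 0%C -> mmul (minv A) A = mid.
Proof. intros H. rewrite minv_cof mscal_mmul cof_l mscal_mscal Cinv_l // mscal_1 //. Qed.

Lemma cof_cancel U A Y : mdet U = 1%C -> mmul (cof (mmul U A)) (mmul U Y) = mmul (cof A) Y.
Proof. intros H. rewrite cof_mul mmul_assoc -(mmul_assoc (cof A)) cof_l H mscal_1 mmul_1_r //. Qed.

(** If [mdet M] were zero then [minv M], and with it the right-hand side, would have
    determinant zero, whereas the left-hand side has determinant 1. *)
Lemma birkhoff_det Um Up L M : mdet Um = 1%C -> mdet Up = 1%C ->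
  mmul (minv Um) Up = mmul L (minv M) ->
  mdet M <> 0%C /\ mdet L = mdet M /\ mmul Um L = mmul Up M.
Proof.
  intros H1 H2 H.
  assert (HM : mdet M <> 0%C).
  { intros h. apply (f_equal mdet) in H. rewrite !mdet_mmul !mdet_minv H1 H2 h in H.
    apply (f_equal fst) in H. revert H. replace (/ 1 * / 1 * 1 * 1)%C with
      (RtoC 1) by (field; apply C1_nz).
    replace (mdet L * (/ 0 * / 0 * 0))%C with (RtoC 0) by ring. simpl. lra. }
  assert (E : mmul Um L = mmul Up M).
  { apply (f_equal (fun Z => mmul Um (mmul Z M))) in H.
    rewrite -!mmul_assoc minv_l // mmul_1_r in H. rewrite !mmul_assoc in H.
    rewrite minv_r ?mmul_1_l in H; [now symmetry|rewrite H1; apply C1_nz]. }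
  split; auto. split; auto.
  apply (f_equal mdet) in E. rewrite !mdet_mmul H1 H2 !Cmult_1_l in E. exact E.
Qed.

Definition mder (F : R -> M2) (t : R) (F' : M2) : Prop :=
  forall i j, (i < 2)%nat -> (j < 2)%nat -> derC (fun s => ent (F s) i j) t (ent F' i j).

Lemma is_mderive_mder F t F' : is_mderive F t F' -> mder F t F'.
Proof. intros H i j _ _. apply is_derive_derC, H. Qed.

Lemma mder_ext_loc F G t F' : locally t (fun s => F s = G s) -> mder F t F' -> mder G t F'.
Proof. intros H HF i j Hi Hj. apply derC_ext_loc with (2 := HF i j Hi Hj).
 revert H; apply filter_imp. intros s ->; auto. Qed.

Lemma mder_unique F t F1 F2 : mder F t F1 -> mder F t F2 -> F1 = F2.
Proof. intros H1 H2. apply M2_ext; intros i j Hi Hj.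
  now apply (derC_unique (fun s => ent (F s) i j) t); [apply H1|apply H2]. Qed.

Lemma derC_ext f g t l : (forall s, f s = g s) -> derC f t l -> derC g t l.
Proof. intros H. apply derC_ext_loc. now apply filter_forall. Qed.

Lemma mder_mul F G t F' G' : mder F t F' -> mder G t G' ->
  mder (fun s => mmul (F s) (G s)) t (madd (mmul F' (G t)) (mmul (F t) G')).
Proof.
  intros HF HG i j Hi Hj.
  apply derC_ext with (fun s => ent (F s) i 0 * ent (G s) 0 j + ent (F s) i 1 * ent (G s) 1 j)%C.
  intros; now rewrite ent_mmul.
  rewrite ent_madd // !ent_mmul //.
  replace (_ + _)%C with ((ent F' i 0 * ent (G t) 0 j + ent (F t) i 0 * ent G' 0 j)
    + (ent F' i 1 * ent (G t) 1 j + ent (F t) i 1 * ent G' 1 j))%C by ring.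
  apply derC_plus; apply (derC_mult (fun s => ent (F s) i _)); auto.
Qed.

Lemma mder_const_l A G t G' : mder G t G' -> mder (fun s => mmul A (G s)) t (mmul A G').
Proof.
  intros HG i j Hi Hj.
  apply derC_ext with (fun s => ent A i 0 * ent (G s) 0 j + ent A i 1 * ent (G s) 1 j)%C.
  intros; now rewrite ent_mmul.
  rewrite !ent_mmul //. apply derC_plus; apply (derC_scal _ (fun s => ent (G s) _ j)); auto.
Qed.

Lemma derC_zero_constant (J : R -> Prop) f : open_interval J -> J 0 ->
  (forall t, J t -> derC f t 0%C) -> forall t, J t -> f t = f 0.
Proof.
  intros HJ H0 H t Ht.
  assert (Hr : forall h : R -> R, (forall t, J t -> is_derive h t 0) -> h t = h 0).
  { intros h Hh. apply Rminus_diag_uniq.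
    assert (Hb := mean_value_bound h (fun _ => 0) 0 t 0).
    assert (Rabs (h t - h 0) <= 0).
    { apply Rle_trans with (0 * Rabs (t - 0)); [apply Hb|lra].
      intros; apply Hh. now apply (open_interval_between J 0 t). intros; rewrite Rabs_R0; lra. }
    apply Rabs_eq_0. generalize (Rabs_pos (h t - h 0)); lra. }
  apply C_ext; [apply (Hr (fun s => Re (f s)))|apply (Hr (fun s => Im (f s)))]; intros s Hs;
    now apply H.
Qed.

(** Liouville's formula: the potential has vanishing trace, so the determinant is constant. *)
Lemma frame_det J eta U (lam : C) : open_interval J -> J 0 -> is_frame J eta U -> lam <> RtoC 0 ->
  (forall t, ent (eta t lam) 0 0 = 0%C /\ ent (eta t lam) 1 1 = 0%C) ->
  forall t, J t -> mdet (U t lam) = 1%C.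
Proof.
  intros HJ H0 HU Hl He t Ht. destruct (HU lam Hl) as [HU0 HU1].
  rewrite -mdet_mid -HU0. apply (derC_zero_constant J (fun t => mdet (U t lam))); auto.
  clear t Ht. intros t Ht. assert (Hd := is_mderive_mder _ _ _ (HU1 t Ht)).
  destruct (He t) as [E0 E1].
  unfold mdet.
  assert (D := derC_minus _ _ _ _ _
    (derC_mult _ _ _ _ _ (Hd 0%nat 0%nat ltac:(lia) ltac:(lia)) (Hd 1%nat 1%nat ltac:(lia) ltac:(lia)))
    (derC_mult _ _ _ _ _ (Hd 0%nat 1%nat ltac:(lia) ltac:(lia)) (Hd 1%nat 0%nat ltac:(lia) ltac:(lia)))).
  revert D. entries_tac. rewrite E0 E1.
  match goal with |- derC ?f ?t ?l -> _ => assert (El : l = RtoC 0) by C_ring_tac; rewrite El end. auto.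
Qed.

(** * The Birkhoff factors *)

Lemma mean_derC (J : R -> Prop) (F Fx : R -> R -> C) x :
  locally x J ->
  (forall u t, J u -> derC (fun s => F s t) u (Fx u t)) ->
  (forall u t, J u -> contC (F u) t) ->
  (forall t, contC (fun p : R * R => Fx (fst p) (snd p)) (x, t)) ->
  derC (fun s => mean (F s)) x (mean (Fx x)).
Proof.
  intros HJ Hd Hc Hcx.
  assert (HP := PI_RGT_0).
  assert (key : forall h hx : R -> R -> R,
    (forall u t, J u -> is_derive (fun s => h s t) u (hx u t)) ->
    (forall u t, J u -> continuous (h u) t) ->
      (forall t, continuous (fun p : R * R => hx (fst p) (snd p)) (x, t)) ->
    is_derive (fun s => RInt (h s) 0 (2*PI) / (2*PI)) x (RInt (hx x) 0 (2*PI) / (2*PI))).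
  { intros h hx H1 H2 H3. apply: is_derive_scal_l.
    apply (is_derive_RInt_Leibniz J (fun _ => True)); auto.
    - intros; apply filter_forall; auto.
    - intros. apply continuity_2d_pt_filterlim. exact (H3 t). }
  split.
  - apply (key (fun s t => Re (F s t)) (fun s t => Re (Fx s t)));
    [intros; now apply (Hd u t) | intros; now apply (Hc u t)| intros; apply (Hcx t)].
  - apply (key (fun s t => Im (F s t)) (fun s t => Im (Fx s t)));
    [intros; now apply (Hd u t) | intros; now apply (Hc u t)| intros; apply (Hcx t)].
Qed.

Lemma ch_neq0 k t : ch k t <> RtoC 0.
Proof. intros h. assert (H := Cmod_expi (IZR k * t)). unfold ch in h. rewrite h Cmod_0 in H. lra. Qed.

Lemma two_ch_neq0 k t : (2 * ch k t)%C <> RtoC 0.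
Proof. apply Cmult_neq_0; [|apply ch_neq0]. intros h. apply (f_equal fst) in h. simpl in h. lra. Qed.

Lemma inv_ch k t : (/ ch k t)%C = ch (- k) t.
Proof.
  assert (H := ch_neq0 k t).
  replace (ch (-k) t) with (/ ch k t * (ch k t * ch (-k) t))%C.
  rewrite -ch_plus Z.add_opp_diag_r ch_0. ring.
  rewrite Cmult_assoc Cinv_l //. ring.
Qed.

Lemma continuous_pair {U V W : UniformSpace} (f : U -> V) (g : U -> W) u :
  continuous f u -> continuous g u -> continuous (fun z => (f z, g z)) u.
Proof. intros Hf Hg. apply (continuous_comp_2 f g (fun a b => (a, b))); auto.
  apply continuous_ext with (fun z => z). now intros []. apply continuous_id. Qed.

Lemma contC_continuous {T : UniformSpace} (f : T -> C) p : contC f p ->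
  @continuous T C_UniformSpace f p.
Proof. intros [H1 H2]. apply (continuous_ext (fun z => (Re (f z), Im (f z)))). intros z;
  now destruct (f z).
  now apply continuous_pair. Qed.

Lemma contC_circle3 (F : R -> R -> C -> M2) (X Y : R * R -> R) i j p :
  continuous X p -> continuous Y p ->
  mcontinuous3 F (X p) (Y p) (ch 1 (snd p)) ->
  contC (fun q : R * R => ent (F (X q) (Y q) (ch 1 (snd q))) i j) p.
Proof.
  intros HX HY H. apply continuous_contC.
  apply (continuous_comp (fun q => (X q, Y q, ch 1 (snd q)))
     (fun z : R * R * C => ent (F (fst (fst z)) (snd (fst z)) (snd z)) i j)); [|apply H].
  apply continuous_pair; [now apply continuous_pair|].
  apply (continuous_comp snd (ch 1)). apply: continuous_snd. destruct p; simpl.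
  apply contC_continuous, contC_ch.
Qed.

Lemma contC_circle (F : R -> R -> C -> M2) x y i j t :
  mcontinuous3 F x y (ch 1 t) -> contC (fun t => ent (F x y (ch 1 t)) i j) t.
Proof.
  intros H. apply continuous_contC.
  apply (continuous_comp (fun q => (x, y, ch 1 q))
     (fun z : R * R * C => ent (F (fst (fst z)) (snd (fst z)) (snd z)) i j)); [|apply H].
  apply continuous_pair; [apply continuous_const|].
  apply contC_continuous, contC_ch.
Qed.

Lemma plus_loop_hardy g : plus_loop g -> (forall i j t, contC (fun t => ent (g (ch 1 t)) i j) t) ->
  exists a : M2, forall i j, hardy 1 (ent a i j) (fun t => ent (g (ch 1 t)) i j).
Proof.
  intros [a Ha] Hc. exists (a O). intros i j.
  assert (H2 : (2 * ch 1 0)%C <> RtoC 0).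
  { apply two_ch_neq0. }
  apply (hardy_pseries 1 (fun n => ent (a n) i j)) with (l2 := ent (g (2 * ch 1 0)%C) i j); auto.
  - now apply Ha.
  - intros; apply Ha, ch_neq0.
Qed.

Lemma minus_loop_hardy g : normalized_minus_loop g ->
  (forall i j t, contC (fun t => ent (g (ch 1 t)) i j) t) ->
  forall i j, hardy (-1) (ent mid i j) (fun t => ent (g (ch 1 t)) i j).
Proof.
  intros [a [Ha0 Ha]] Hc i j. rewrite -Ha0.
  assert (H2 : (/ (2 * ch (-1) 0))%C <> RtoC 0).
  { intros h. apply C1_nz. rewrite -(Cinv_r (2 * ch (-1) 0)%C (two_ch_neq0 _ _)) h. ring. }
  apply (hardy_pseries (-1) (fun n => ent (a n) i j)) with
    (l2 := ent (g (/ (2 * ch (-1) 0))%C) i j); auto.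
  - specialize (Ha _ H2 i j). replace (/ / (2 * ch (-1) 0))%C with (2 * ch (-1) 0)%C in Ha; [exact Ha|].
    field. apply ch_neq0.
  - intros t. specialize (Ha _ (ch_neq0 1 t) i j). now rewrite inv_ch in Ha.
Qed.

(** The frame equals [Um L] and [Up M], and [Um] is constant in x while [Up] is constant in y.
    Each partial derivative therefore has two expressions; after multiplication by the adjugate
    of the frame the factors [Um] and [Up] cancel, their determinant being 1. *)
Lemma birkhoff_identities Jp Jm alpha beta Up Um Lp Lm phi (lam : C) x y Lpx Lpy Lmx Lmy :
  open_interval Jp -> Jp 0 -> open_interval Jm -> Jm 0 ->
  is_frame Jp (eta_plus alpha) Up -> is_frame Jm (eta_minus beta) Um ->
  is_birkhoff Jp Jm Up Um Lp Lm -> is_angle Jp Jm beta (Uhat Um Lp) phi ->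
  lam <> RtoC 0 -> Jp x -> Jm y ->
  mder (fun s => Lp s y lam) x Lpx -> mder (fun s => Lp x s lam) y Lpy ->
  mder (fun s => Lm s y lam) x Lmx -> mder (fun s => Lm x s lam) y Lmy ->
  let L := Lp x y lam in let M := Lm x y lam in
  let B := mscal (- (Ci / RtoC 2) * / lam)%C (offdiag (phi x y)) in
  mdet L = mdet M /\
  mmul (cof L) Lpx = madd (mmul (cof M) (mmul (eta_plus alpha x lam) M)) (mmul (cof M) Lmx) /\
  madd (mmul (cof L) (mmul (eta_minus beta y lam) L)) (mmul (cof L) Lpy) = mscal (mdet M) B /\
  Lmy = mmul M B.
Proof.
  intros HJp H0p HJm H0m HUp HUm [HB _] [_ [_ Hang]] Hl Hx Hy DLpx DLpy DLmx DLmy L M B.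
  assert (dUp : forall x, Jp x -> mdet (Up x lam) = 1%C).
  { apply (frame_det Jp (eta_plus alpha)); auto. intros t; split; unfold eta_plus, offdiag;
      entries_tac; ring. }
  assert (dUm : forall y, Jm y -> mdet (Um y lam) = 1%C).
  { apply (frame_det Jm (eta_minus beta)); auto. intros t; split; unfold eta_minus, offdiag;
      entries_tac; ring. }
  assert (Bk : forall x y, Jp x -> Jm y -> mdet (Lm x y lam) <> 0%C /\ mdet (Lp x y lam) =
    mdet (Lm x y lam) /\
    mmul (Um y lam) (Lp x y lam) = mmul (Up x lam) (Lm x y lam)).
  { intros u v Hu Hv. apply birkhoff_det;
      [now apply dUm|now apply dUp|exact (proj1 (HB u v Hu Hv) lam Hl)]. }
  destruct (Bk x y Hx Hy) as [HM [HLM HU]]. fold L M in HM, HLM, HU.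
  assert (DUp := is_mderive_mder _ _ _ (proj2 (HUp lam Hl) x Hx)).
  assert (DUm := is_mderive_mder _ _ _ (proj2 (HUm lam Hl) y Hy)).
  split; [exact HLM|].
  split; [|].
  - assert (D1 := mder_const_l (Um y lam) _ _ _ DLpx).
    assert (D2 := mder_mul _ _ _ _ _ DUp DLmx).
    apply mder_ext_loc with (G := fun s => mmul (Um y lam) (Lp s y lam)) in D2.
    2: { generalize (open_interval_locally _ _ HJp Hx). apply filter_imp. intros s Hs. symmetry;
      now apply Bk. }
    assert (E := mder_unique _ _ _ _ D1 D2). fold M in E.
    rewrite -mmul_assoc -mmul_madd in E.
    rewrite -mmul_madd -(cof_cancel (Um y lam) L Lpx) ?dUm // HU E cof_cancel ?dUp //.
  - destruct (Hang x y lam Hx Hy Hl) as [Uy [HUy HUB]].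
    apply is_mderive_mder in HUy.
    assert (D1 := mder_mul _ _ _ _ _ DUm DLpy).
    assert (E1 := mder_unique _ _ _ _ HUy D1).
    assert (D2 := mder_const_l (Up x lam) _ _ _ DLmy).
    apply mder_ext_loc with (G := fun s => mmul (Um s lam) (Lp x s lam)) in D2.
    2: { generalize (open_interval_locally _ _ HJm Hy). apply filter_imp. intros s Hs. symmetry;
      now apply Bk. }
    assert (E2 := mder_unique _ _ _ _ HUy D2). fold L in E1. fold B in HUB.
    assert (HcB : mmul (cof (Uhat Um Lp x y lam)) Uy = mscal (mdet M) B).
    { rewrite -HUB minv_cof. unfold Uhat. fold L. rewrite mdet_mmul dUm // Cmult_1_l HLM.
      rewrite mscal_mmul mscal_mscal Cinv_r // mscal_1 //. }
    unfold Uhat in HcB. fold L in HcB.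
    split.
    + rewrite -HcB E1 -mmul_assoc -!mmul_madd cof_cancel ?dUm //.
    + assert (HM2 : mmul (cof M) Lmy = mscal (mdet M) B).
      { rewrite -HcB HU E2 cof_cancel ?dUp //. }
      apply (f_equal (fun Z => mscal (/ mdet M) (mmul M Z))) in HM2.
      rewrite mmul_assoc cof_r mmul_mscal mscal_mmul !mscal_mscal Cinv_l // !mscal_1 mmul_1_l in HM2. exact HM2.
Qed.

(** The entry (0,1) of a twisted loop is an odd function of lam, so its constant coefficient is
    its own opposite. *)
Lemma twisted_offdiag g : plus_loop g -> twisted g ->
  (forall i j t, contC (fun t => ent (g (ch 1 t)) i j) t) ->
  mean (fun t => ent (g (ch 1 t)) 0 1) = 0%C.
Proof.
  intros [a Ha] Ht Hc.
  set (f := fun t => ent (g (ch 1 t)) 0 1).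
  assert (Cf : forall t, contC f t) by (intros; apply Hc).
  assert (tw : forall lam, lam <> RtoC 0 -> ent (g (- lam)%C) 0 1 = (- ent (g lam) 0 1)%C).
  { intros lam Hl. rewrite Ht // minv_cof. unfold sigma3, cof, mdet. entries_tac. field. }
  assert (neg : forall z, z <> RtoC 0 -> (- z)%C <> RtoC 0).
  { intros z Hz h. apply Hz. replace z with (- - z)%C by ring. rewrite h. ring. }
  assert (E1 : mean f = ent (a O) 0 1).
  { apply (mean_hardy 1); [lia|].
    apply (hardy_pseries 1 (fun n => ent (a n) 0 1) f (ent (g (2 * ch 1 0)%C) 0 1)); auto.
    - apply Ha, two_ch_neq0.
    - intros; apply Ha, ch_neq0. }
  assert (E2 : mean (fun t => -(1) * f t)%C = ent (a O) 0 1).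
  { apply (mean_hardy 1); [lia|].
    assert (H := hardy_pseries 1 (fun n => pow_n (K:=C_Ring) (- (1))%C n * ent (a n) 0 1)%C (fun t => -(1) * f t)%C (ent (g (- (2 * ch 1 0))%C) 0 1)).
    cbv beta in H. replace (pow_n (K:=C_Ring) (- (1))%C 0 * ent (a O) 0 1)%C with (ent (a O) 0 1) in H.
    2: { simpl. rewrite /one /=. ring. }
    apply H.
    - apply pseries_opp_arg, Ha, neg, two_ch_neq0.
    - intros. contC_tac.
    - intros t. replace (- (1) * f t)%C with (ent (g (- ch 1 t)%C) 0 1).
      apply pseries_opp_arg, Ha, neg, ch_neq0. rewrite tw. unfold f; ring. apply ch_neq0. }
  rewrite mean_scal // E1 in E2. rewrite E1.
  apply C_ext; [apply (f_equal fst) in E2|apply (f_equal snd) in E2]; revert E2; simpl; unfold Re,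
    Im; lra.
Qed.

(** With [ch m] as weight this is the coefficient of lam^(-m). *)
Definition loop_coef (F : R -> R -> C -> M2) (m : Z) (i j : nat) (x y : R) : C :=
  mean (fun t => ch m t * ent (F x y (ch 1 t)) i j)%C.

Lemma loop_coef_derC_x (Jp Jm : R -> Prop) F Fx m i j x y : open_interval Jp -> Jp x -> Jm y ->
  (forall u v lam, Jp u -> Jm v -> lam <> RtoC 0 ->
     is_mderive (fun s => F s v lam) u (Fx u v lam) /\ mcontinuous3 F u v lam /\
       mcontinuous3 Fx u v lam) ->
  derC (fun s => loop_coef F m i j s y) x (loop_coef Fx m i j x y).
Proof.
  intros HJ Hx Hy H.
  apply (mean_derC Jp (fun s t => ch m t * ent (F s y (ch 1 t)) i j)%C (fun s t => ch m t * ent (Fx s y (ch 1 t)) i j)%C).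
  - now apply open_interval_locally.
  - intros u t Hu. apply (derC_scal (ch m t) (fun s => ent (F s y (ch 1 t)) i j)).
    apply is_derive_derC. exact (proj1 (H u y (ch 1 t) Hu Hy (ch_neq0 1 t)) i j).
  - intros u t Hu. apply contC_mult; [apply contC_ch|]. apply contC_circle.
    exact (proj1 (proj2 (H u y (ch 1 t) Hu Hy (ch_neq0 1 t)))).
  - intros t. apply contC_mult.
    + destruct (contC_ch m t) as [a b].
      split; [apply (continuous_comp snd (fun t => Re (ch m t)))|apply (continuous_comp snd (fun t => Im (ch m t)))];
      try exact a; try exact b; apply: continuous_snd.
    + apply (contC_circle3 Fx fst (fun _ => y)). apply: continuous_fst. apply: continuous_const.
      exact (proj2 (proj2 (H x y (ch 1 t) Hx Hy (ch_neq0 1 t)))).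
Qed.

Lemma loop_coef_derC_y (Jp Jm : R -> Prop) F Fy m i j x y : open_interval Jm -> Jp x -> Jm y ->
  (forall u v lam, Jp u -> Jm v -> lam <> RtoC 0 ->
     is_mderive (fun s => F u s lam) v (Fy u v lam) /\ mcontinuous3 F u v lam /\
       mcontinuous3 Fy u v lam) ->
  derC (fun s => loop_coef F m i j x s) y (loop_coef Fy m i j x y).
Proof.
  intros HJ Hx Hy H.
  apply (mean_derC Jm (fun s t => ch m t * ent (F x s (ch 1 t)) i j)%C (fun s t => ch m t * ent (Fy x s (ch 1 t)) i j)%C).
  - now apply open_interval_locally.
  - intros u t Hu. apply (derC_scal (ch m t) (fun s => ent (F x s (ch 1 t)) i j)).
    apply is_derive_derC. exact (proj1 (H x u (ch 1 t) Hx Hu (ch_neq0 1 t)) i j).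
  - intros u t Hu. apply contC_mult; [apply contC_ch|]. apply contC_circle.
    exact (proj1 (proj2 (H x u (ch 1 t) Hx Hu (ch_neq0 1 t)))).
  - intros t. apply contC_mult.
    + destruct (contC_ch m t) as [a b].
      split; [apply (continuous_comp snd (fun t => Re (ch m t)))|apply (continuous_comp snd (fun t => Im (ch m t)))];
      try exact a; try exact b; apply: continuous_snd.
    + apply (contC_circle3 Fy (fun _ => x) fst). apply: continuous_const. apply: continuous_fst.
      exact (proj2 (proj2 (H x y (ch 1 t) Hx Hy (ch_neq0 1 t)))).
Qed.

Lemma derC_constant (J : R -> Prop) f c x l : open_interval J -> J x ->
  (forall s, J s -> f s = c) -> derC f x l -> l = 0%C.
Proof.
  intros HJ Hx Hf H. apply (derC_unique f x). exact H.
  apply derC_ext_loc with (fun _ => c); [|apply derC_const].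
  generalize (open_interval_locally _ _ HJ Hx). apply filter_imp. intros; now rewrite Hf.
Qed.

(** Here [p] and [q] are the diagonal constant terms of [Lp], and [n], [m] are the coefficients
    of 1/lam in the entries (0,1) and (1,0) of [Lm]. *)
Lemma birkhoff_coefficients
  (Jp Jm : R -> Prop) (alpha beta : R -> R)
  (Up Um : R -> C -> M2) (Lp Lm : R -> R -> C -> M2) (phi : R -> R -> R)
  (HJp : open_interval Jp) (HJp0 : Jp 0) (HJm : open_interval Jm) (HJm0 : Jm 0)
  (HUp : is_frame Jp (eta_plus alpha) Up) (HUm : is_frame Jm (eta_minus beta) Um)
  (HL : is_birkhoff Jp Jm Up Um Lp Lm)
  (Hphi : is_angle Jp Jm beta (Uhat Um Lp) phi) :
  exists p q px n m nx mx : R -> R -> C, forall x y, Jp x -> Jm y ->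
    (p x y * q x y = 1)%C /\
    (expi (phi x y) = expi (beta y) * (q x y * q x y))%C /\
    derC (fun s => p s y) x (px x y) /\
    (q x y * px x y = Ci / 2 * (expi (- alpha x) * m x y - expi (alpha x) * n x y))%C /\
    derC (fun s => m x s) y (- (Ci / 2) * expi (- phi x y))%C /\
    derC (fun s => n x s) y (- (Ci / 2) * expi (phi x y))%C /\
    derC (fun s => m s y) x (mx x y) /\
    derC (fun s => n s y) x (nx x y).
Proof.
  assert (HL' := HL). destruct HL' as [HB [[Lpx [Lpy HLp]] [Lmx [Lmy HLm]]]].
  assert (cLp : forall x y, Jp x -> Jm y -> forall i j (t : R),
    contC (fun t => ent (Lp x y (ch 1 t)) i j) t).
  { intros x y Hx Hy i j t. apply contC_circle, (HLp x y (ch 1 t) Hx Hy (ch_neq0 1 t)). }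
  assert (cLm : forall x y, Jp x -> Jm y -> forall i j (t : R),
    contC (fun t => ent (Lm x y (ch 1 t)) i j) t).
  { intros x y Hx Hy i j t. apply contC_circle, (HLm x y (ch 1 t) Hx Hy (ch_neq0 1 t)). }
  assert (cLpx : forall x y, Jp x -> Jm y -> forall i j (t : R),
    contC (fun t => ent (Lpx x y (ch 1 t)) i j) t).
  { intros x y Hx Hy i j t. apply contC_circle, (HLp x y (ch 1 t) Hx Hy (ch_neq0 1 t)). }
  assert (cLpy : forall x y, Jp x -> Jm y -> forall i j (t : R),
    contC (fun t => ent (Lpy x y (ch 1 t)) i j) t).
  { intros x y Hx Hy i j t. apply contC_circle, (HLp x y (ch 1 t) Hx Hy (ch_neq0 1 t)). }
  assert (cLmx : forall x y, Jp x -> Jm y -> forall i j (t : R),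
    contC (fun t => ent (Lmx x y (ch 1 t)) i j) t).
  { intros x y Hx Hy i j t. apply contC_circle, (HLm x y (ch 1 t) Hx Hy (ch_neq0 1 t)). }
  assert (dLpx : forall m i j x y, Jp x -> Jm y ->
    derC (fun s => loop_coef Lp m i j s y) x (loop_coef Lpx m i j x y)).
  { intros m i j x y Hx Hy. apply (loop_coef_derC_x Jp Jm); auto. intros u v lam Hu Hv Hl.
    now destruct (HLp u v lam Hu Hv Hl) as [? [? [? [? ?]]]]. }
  assert (dLpy : forall m i j x y, Jp x -> Jm y ->
    derC (fun s => loop_coef Lp m i j x s) y (loop_coef Lpy m i j x y)).
  { intros m i j x y Hx Hy. apply (loop_coef_derC_y Jp Jm); auto. intros u v lam Hu Hv Hl.
    now destruct (HLp u v lam Hu Hv Hl) as [? [? [? [? ?]]]]. }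
  assert (dLmx : forall m i j x y, Jp x -> Jm y ->
    derC (fun s => loop_coef Lm m i j s y) x (loop_coef Lmx m i j x y)).
  { intros m i j x y Hx Hy. apply (loop_coef_derC_x Jp Jm); auto. intros u v lam Hu Hv Hl.
    now destruct (HLm u v lam Hu Hv Hl) as [? [? [? [? ?]]]]. }
  assert (dLmy : forall m i j x y, Jp x -> Jm y ->
    derC (fun s => loop_coef Lm m i j x s) y (loop_coef Lmy m i j x y)).
  { intros m i j x y Hx Hy. apply (loop_coef_derC_y Jp Jm); auto. intros u v lam Hu Hv Hl.
    now destruct (HLm u v lam Hu Hv Hl) as [? [? [? [? ?]]]]. }
  assert (c0 : forall F i j x y, loop_coef F 0 i j x y = mean (fun t => ent (F x y (ch 1 t)) i j)).
  { intros. apply mean_ext. intros. rewrite ch_0. ring. }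
  assert (hLp : forall x y, Jp x -> Jm y -> forall i j,
    hardy 1 (loop_coef Lp 0 i j x y) (fun t => ent (Lp x y (ch 1 t)) i j)).
  { intros x y Hx Hy i j. destruct (HB x y Hx Hy) as [_ [_ [_ [Hpl _]]]].
    destruct (plus_loop_hardy _ Hpl) as [a Ha]. exact (cLp x y Hx Hy).
    rewrite c0 (mean_hardy 1 (ent a i j)) //. }
  assert (hLm : forall x y, Jp x -> Jm y -> forall i j,
    hardy (-1) (ent mid i j) (fun t => ent (Lm x y (ch 1 t)) i j)).
  { intros x y Hx Hy i j. destruct (HB x y Hx Hy) as [_ [_ [_ [_ Hmi]]]].
    apply (minus_loop_hardy _ Hmi). exact (cLm x y Hx Hy). }
  assert (off : forall x y, Jp x -> Jm y -> loop_coef Lp 0 0 1 x y = 0%C).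
  { intros x y Hx Hy. destruct (HB x y Hx Hy) as [_ [[Htw _] [_ [Hpl _]]]].
    rewrite c0. apply twisted_offdiag; auto. }
  assert (vLp : forall n, (1 <= n)%nat -> forall i j x y, Jp x -> Jm y ->
    loop_coef Lp (1 * Z.of_nat n) i j x y = 0%C).
  { intros n Hn i j x y Hx Hy. unfold loop_coef. eapply mean_ch_hardy; [lia|now apply hLp|lia]. }
  assert (vLm : forall n, forall i j x y, Jp x -> Jm y -> loop_coef Lm (-1 * Z.of_nat n) i j x y =
    match n with O => ent mid i j | _ => 0%C end).
  { intros n i j x y Hx Hy. destruct n.
    - change (-1 * Z.of_nat 0)%Z with 0%Z. rewrite c0. apply (mean_hardy (-1)); [lia|]. now apply hLm.
    - unfold loop_coef. eapply mean_ch_hardy; [lia|now apply hLm|lia]. }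
  (* Coefficients that vanish identically in x and y have vanishing derivatives. *)
  assert (vLpx : forall n, (1 <= n)%nat -> forall i j x y, Jp x -> Jm y ->
    loop_coef Lpx (1 * Z.of_nat n) i j x y = 0%C).
  { intros n Hn i j x y Hx Hy. apply (derC_constant Jp (fun s => loop_coef Lp (1 * Z.of_nat n) i j s y) 0%C x); [exact HJp|exact Hx| |exact (dLpx _ i j x y Hx Hy)].
    intros s Hs. exact (vLp n Hn i j s y Hs Hy). }
  assert (vLpy : forall n, (1 <= n)%nat -> forall i j x y, Jp x -> Jm y ->
    loop_coef Lpy (1 * Z.of_nat n) i j x y = 0%C).
  { intros n Hn i j x y Hx Hy. apply (derC_constant Jm (fun s => loop_coef Lp (1 * Z.of_nat n) i j x s) 0%C y); [exact HJm|exact Hy| |exact (dLpy _ i j x y Hx Hy)].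
    intros s Hs. exact (vLp n Hn i j x s Hx Hs). }
  (* The constant coefficient of the minus factor is the identity matrix, so its derivative
     vanishes too: hence no lower bound on n here. *)
  assert (vLmx : forall n, forall i j x y, Jp x -> Jm y -> loop_coef Lmx (-1 * Z.of_nat n) i j x y =
    0%C).
  { intros n i j x y Hx Hy. eapply (derC_constant Jp (fun s => loop_coef Lm (-1 * Z.of_nat n) i j s y)); [exact HJp|exact Hx| |exact (dLmx _ i j x y Hx Hy)].
    intros s Hs. exact (vLm n i j s y Hs Hy). }
  assert (Id : forall x y t, Jp x -> Jm y -> let L := Lp x y (ch 1 t) in let M := Lm x y (ch 1 t) in
    let B := mscal (- (Ci / RtoC 2) * / ch 1 t)%C (offdiag (phi x y)) in
    mdet L = mdet M /\
    mmul (cof L) (Lpx x y (ch 1 t)) =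
      madd (mmul (cof M) (mmul (eta_plus alpha x (ch 1 t)) M)) (mmul (cof M) (Lmx x y (ch 1 t))) /\
    madd (mmul (cof L) (mmul (eta_minus beta y (ch 1 t)) L)) (mmul (cof L) (Lpy x y (ch 1 t))) =
      mscal (mdet M) B /\
    Lmy x y (ch 1 t) = mmul M B).
  { intros x y t Hx Hy.
    destruct (HLp x y _ Hx Hy (ch_neq0 1 t)) as [a1 [a2 _]].
    destruct (HLm x y _ Hx Hy (ch_neq0 1 t)) as [a3 [a4 _]].
    apply (birkhoff_identities Jp Jm alpha beta Up Um Lp Lm phi); auto using is_mderive_mder, ch_neq0. }
  clear HLp HLm HL Hphi HUp HUm HB.
  destruct ent_mid as [m00 [m01 [m10 m11]]].
  exists (loop_coef Lp 0 0 0), (loop_coef Lp 0 1 1), (loop_coef Lpx 0 0 0), (loop_coef Lm 1 0 1),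
    (loop_coef Lm 1 1 0), (loop_coef Lmx 1 0 1), (loop_coef Lmx 1 1 0).
  intros x y Hx Hy.
  specialize (hLp x y Hx Hy). specialize (hLm x y Hx Hy). specialize (cLp x y Hx Hy).
  specialize (cLm x y Hx Hy).
  assert (h01 := hLp 0%nat 1%nat). rewrite (off x y Hx Hy) in h01.
  assert (g00 := hLm 0%nat 0%nat). rewrite m00 in g00.
  assert (g01 := hLm 0%nat 1%nat). rewrite m01 in g01.
  assert (g10 := hLm 1%nat 0%nat). rewrite m10 in g10.
  assert (g11 := hLm 1%nat 1%nat). rewrite m11 in g11.
  (* The mean of det Lp = det Lm is 1 when computed from the minus factor, and p q from the plus
     factor. *)
  assert (Hdet : mean (fun t => mdet (Lm x y (ch 1 t))) = 1%C).
  { unfold mdet. rewrite (mean_det_hardy (-1) _ _ _ _ _ _ _ _ ltac:(lia) g00 g01 g10 g11). ring. }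
  split; [|split; [|split; [|split; [|split; [|split; [|split]]]]]]; auto.
  - rewrite -Hdet. rewrite -(mean_ext (fun t => mdet (Lp x y (ch 1 t)))). 2: intros t; now apply Id.
    unfold mdet. rewrite (mean_det_hardy 1 _ _ _ _ _ _ _ _ ltac:(lia) (hLp 0%nat 0%nat) h01 (hLp 1%nat 0%nat) (hLp 1%nat 1%nat)). ring.
  - assert (Y := mean_y_equation (- (Ci / 2) * expi (beta y)) (- (Ci / 2) * expi (- beta y)) (- (Ci / 2) * expi (phi x y))
      (loop_coef Lp 0 1 1 x y) _ _ (fun t => ent (Lpy x y (ch 1 t)) 0 1) (fun t => ent (Lpy x y (ch 1 t)) 1 1)
      (fun t => mdet (Lm x y (ch 1 t))) (hLp 1%nat 1%nat) h01).
    assert (Hi : (- (Ci / 2))%C <> RtoC 0).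
    { intros h. apply (f_equal snd) in h. simpl in h. lra. }
    (* Multiplication by lam turns the factor 1/lam of the potential into 1. *)
    assert (Y' : (- (Ci / 2) * expi (beta y) * (loop_coef Lp 0 1 1 x y * loop_coef Lp 0 1 1 x y))%C = (- (Ci / 2) * expi (phi x y))%C).
    { apply Y; clear Y.
      - intros; exact (cLpy x y Hx Hy _ _ _).
      - intros; exact (cLpy x y Hx Hy _ _ _).
      - intros n Hn. exact (vLpy n Hn _ _ x y Hx Hy).
      - intros n Hn. exact (vLpy n Hn _ _ x y Hx Hy).
      - intros t. unfold mdet. contC_tac; apply cLm.
      - exact Hdet.
      - intros t. destruct (Id x y t Hx Hy) as [_ [_ [H _]]].
        apply (f_equal (fun Z => ch 1 t * ent Z 0 1)%C) in H. revert H.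
        unfold cof, eta_minus, offdiag. entries_tac. intros H.
        assert (hn := ch_neq0 1 t).
        transitivity (ch 1 t * / ch 1 t * (- (Ci / 2)) * expi (phi x y) * mdet (Lm x y (ch 1 t)))%C.
        2: { rewrite Cinv_r //. ring. }
        etransitivity; [|etransitivity; [exact H|ring]].
        transitivity (ch 1 t * / ch 1 t * (- (Ci / 2) * expi (beta y) * (ent (Lp x y (ch 1 t)) 1 1 * ent (Lp x y (ch 1 t)) 1 1) -
   - (Ci / 2) * expi (- beta y) * (ent (Lp x y (ch 1 t)) 0 1 * ent (Lp x y (ch 1 t)) 0 1)) +
   (ent (Lp x y (ch 1 t)) 1 1 * (ch 1 t * ent (Lpy x y (ch 1 t)) 0 1) -
    ent (Lp x y (ch 1 t)) 0 1 * (ch 1 t * ent (Lpy x y (ch 1 t)) 1 1)))%C.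
        rewrite Cinv_r //. ring. ring. }
    apply (f_equal (fun z => / (- (Ci / 2)) * z)%C) in Y'.
    rewrite !Cmult_assoc Cinv_l // !Cmult_1_l in Y'.
    rewrite -Y'. ring.
  - rewrite (c0 Lpx).
    rewrite (mean_x_equation (Ci / 2 * expi (- alpha x)) (Ci / 2 * expi (alpha x)) (loop_coef Lp 0 1 1 x y)
       (fun t => ent (Lp x y (ch 1 t)) 1 1) (fun t => ent (Lp x y (ch 1 t)) 0 1)
       (fun t => ent (Lpx x y (ch 1 t)) 0 0) (fun t => ent (Lpx x y (ch 1 t)) 1 0)
       (fun t => ent (Lm x y (ch 1 t)) 0 0) (fun t => ent (Lm x y (ch 1 t)) 0 1)
       (fun t => ent (Lm x y (ch 1 t)) 1 0) (fun t => ent (Lm x y (ch 1 t)) 1 1)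
       (fun t => ent (Lmx x y (ch 1 t)) 0 0) (fun t => ent (Lmx x y (ch 1 t)) 1 0)); auto;
      try (intros n Hn; exact (vLpx n Hn _ _ x y Hx Hy)); try (intros n; exact (vLmx n _ _ x y Hx Hy)).
    + unfold loop_coef. ring.
    + intros t. destruct (Id x y t Hx Hy) as [_ [H _]].
      apply (f_equal (fun Z => ent Z 0 0)) in H. revert H.
      unfold cof, eta_plus, offdiag. entries_tac. rewrite Ropp_involutive. intros H.
      etransitivity; [|etransitivity; [exact H|]]; ring.
  - replace (- (Ci / 2) * expi (- phi x y))%C with (loop_coef Lmy 1 1 0 x y); auto.
    unfold loop_coef. rewrite (mean_ext _ (fun t => - (Ci / 2) * expi (- phi x y) * ent (Lm x y (ch 1 t)) 1 1)%C).
    + rewrite (mean_scal _ (fun t => ent (Lm x y (ch 1 t)) 1 1)); [|intros; apply cLm].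
      rewrite (mean_hardy (-1) 1) //. ring.
    + intros t. destruct (Id x y t Hx Hy) as [_ [_ [_ ->]]]. unfold offdiag. entries_tac.
      transitivity (ch 1 t * / ch 1 t * (- (Ci / 2) * expi (- phi x y) * ent (Lm x y (ch 1 t)) 1 1))%C; [ring|].
      rewrite Cinv_r ?Cmult_1_l //. apply ch_neq0.
  - replace (- (Ci / 2) * expi (phi x y))%C with (loop_coef Lmy 1 0 1 x y); auto.
    unfold loop_coef. rewrite (mean_ext _ (fun t => - (Ci / 2) * expi (phi x y) * ent (Lm x y (ch 1 t)) 0 0)%C).
    + rewrite (mean_scal _ (fun t => ent (Lm x y (ch 1 t)) 0 0)); [|intros; apply cLm].
      rewrite (mean_hardy (-1) 1) //. ring.
    + intros t. destruct (Id x y t Hx Hy) as [_ [_ [_ ->]]]. unfold offdiag. entries_tac.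
      transitivity (ch 1 t * / ch 1 t * (- (Ci / 2) * expi (phi x y) * ent (Lm x y (ch 1 t)) 0 0))%C; [ring|].
      rewrite Cinv_r ?Cmult_1_l //. apply ch_neq0.
Qed.

(** * The sine-Gordon equation *)

Lemma expi_opp_mul a : (expi a * expi (- a))%C = RtoC 1.
Proof. rewrite -expi_plus Rplus_opp_r. apply expi_0. Qed.

(** From p^2 = exp(-i (phi - beta)) and p q = 1 the x-derivative of the angle is 2 i q p_x,
    which equals -(exp(-i alpha) m - exp(i alpha) n). Along y only [m] and [n] vary, with known
    derivatives. *)
Lemma angle_potential
  (Jp Jm : R -> Prop) (alpha beta : R -> R)
  (Up Um : R -> C -> M2) (Lp Lm : R -> R -> C -> M2) (phi : R -> R -> R)
  (HJp : open_interval Jp) (HJp0 : Jp 0) (HJm : open_interval Jm) (HJm0 : Jm 0)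
  (Ha : forall x, Jp x -> continuous alpha x)
  (HUp : is_frame Jp (eta_plus alpha) Up) (HUm : is_frame Jm (eta_minus beta) Um)
  (HL : is_birkhoff Jp Jm Up Um Lp Lm)
  (Hphi : is_angle Jp Jm beta (Uhat Um Lp) phi) :
  exists w : R -> R -> R, forall x y, Jp x -> Jm y ->
    is_derive (fun s => phi s y - beta y) x (w x y) /\
    is_derive (fun s => w x s) y (sin (phi x y + alpha x)) /\
    continuous (fun s => w s y) x.
Proof.
  destruct (birkhoff_coefficients Jp Jm alpha beta Up Um Lp Lm phi) as [p [q [px [n [m [nx [mx H]]]]]]]; auto.
  exists (fun x y => - Re (expi (- alpha x) * m x y - expi (alpha x) * n x y)%C).
  intros x y Hx Hy.
  destruct (H x y Hx Hy) as [pq [_ [dp [ex [dm [dn [dmx dnx]]]]]]].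
  split; [|split].
  - set (f := fun s => phi s y - beta y).
    (* This combines exp(i phi) = exp(i beta) q^2 with p q = 1. *)
    assert (Hp2 : forall s, Jp s -> expi (- f s) = (p s y * p s y)%C).
    { intros s Hs. destruct (H s y Hs Hy) as [pqs [es _]].
      transitivity (expi (- f s) * ((p s y * q s y) * (p s y * q s y)))%C. rewrite pqs; ring.
      transitivity ((p s y * p s y) * (expi (- f s) * (expi (- beta y) * expi (beta y)) * (q s y * q s y)))%C.
      rewrite (Cmult_comm (expi (- beta y))) expi_opp_mul; ring.
      transitivity ((p s y * p s y) * (expi (- f s) * expi (- beta y) * (expi (beta y) * (q s y * q s y))))%C; [ring|].
      rewrite -es -expi_plus. replace (- f s + - beta y) with (- phi s y) by (unfold f; ring).
      rewrite (Cmult_comm (expi (- phi s y))) expi_opp_mul. ring. }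
    assert (D := derC_mult _ _ _ _ _ dp dp).
    assert (Dc : derC (fun s => expi (- f s)) x (px x y * p x y + p x y * px x y)%C).
    { apply derC_ext_loc with (2 := D). generalize (open_interval_locally _ _ HJp Hx). apply filter_imp.
      intros s Hs; symmetry; auto. }
    destruct Dc as [D1 D2].
    assert (Dcos : is_derive (fun s => cos (f s)) x (Re (px x y * p x y + p x y * px x y)%C)).
    { apply is_derive_ext with (2 := D1). intros s. unfold expi. apply cos_neg. }
    assert (Dsin : is_derive (fun s => sin (f s)) x (- Im (px x y * p x y + p x y * px x y)%C)).
    { apply is_derive_ext with (fun s => - Im (expi (- f s))). intros s. unfold expi; simpl.
      rewrite sin_neg. ring.
      apply: is_derive_opp. exact D2. }
    assert (Cf : continuous f x).
    { apply: continuous_minus; [|apply: continuous_const]. apply (continuity_2d_pt_fst phi).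
      now apply (proj1 Hphi). }
    assert (Df := derive_angle f x _ _ Cf Dcos Dsin).
    assert (El : ((px x y * p x y + p x y * px x y) * expi (f x) =
      Ci * (expi (- alpha x) * m x y - expi (alpha x) * n x y))%C).
    { transitivity (2 * (Ci / 2 * (expi (- alpha x) * m x y - expi (alpha x) * n x y)))%C;
        [rewrite -ex|field].
      transitivity ((p x y * q x y) * (2 * px x y * p x y) * expi (f x))%C. rewrite pq; ring.
      transitivity (2 * (q x y * px x y) * (expi (f x) * (p x y * p x y)))%C; [ring|].
      rewrite -Hp2 // expi_opp_mul. ring. }
    match type of Df with is_derive _ _ ?l => replace (- _) with l; [exact Df|] end.
    apply (f_equal Im) in El. revert El.
    set (l := (px x y * p x y + p x y * px x y)%C).
    set (z := (expi (- alpha x) * m x y - expi (alpha x) * n x y)%C).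
    clearbody l z. destruct l, z. unfold expi; simpl. lra.
  - assert (D : derC (fun s => expi (- alpha x) * m x s - expi (alpha x) * n x s)%C y
       (expi (- alpha x) * (- (Ci / 2) * expi (- phi x y)) - expi (alpha x) * (- (Ci / 2) * expi (phi x y)))%C).
    { apply derC_minus; apply (derC_scal _ (fun s => _ x s)); auto. }
    destruct D as [D _]. apply (is_derive_opp (V:=R_NormedModule)) in D.
    match type of D with is_derive _ _ ?l => replace (sin _) with l; [exact D|] end.
    replace (expi (- alpha x) * (- (Ci / 2) * expi (- phi x y)) - expi (alpha x) * (- (Ci / 2) * expi (phi x y)))%C
      with (- (Ci / 2) * (expi (- alpha x + - phi x y) - expi (alpha x + phi x y)))%C by (rewrite !expi_plus; ring).
    replace (- alpha x + - phi x y) with (- (phi x y + alpha x)) by ring.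
    rewrite (Rplus_comm (alpha x)).
    unfold opp, expi; simpl. rewrite cos_neg sin_neg. field.
  - apply (continuous_opp (V:=R_NormedModule)).
    assert (Cc : contC (fun s => expi (- alpha s) * m s y - expi (alpha s) * n s y)%C x).
    { apply contC_minus; apply contC_mult.
      - apply (contC_expi (fun s => - alpha s)). apply (continuous_opp (V:=R_NormedModule)); auto.
      - eapply (derC_contC (fun s => m s y)); eauto.
      - apply contC_expi; auto.
      - eapply (derC_contC (fun s => n s y)); eauto. }
    exact (proj1 Cc).
Qed.

Theorem theorem2p18
  (Jp Jm : R -> Prop) (alpha beta : R -> R)
  (Up Um : R -> C -> M2) (Lp Lm : R -> R -> C -> M2)
  (phi_hat phi_tilde phi_check : R -> R -> R)
  (HJp : open_interval Jp) (HJp0 : Jp 0)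
  (HJm : open_interval Jm) (HJm0 : Jm 0)
  (Halpha : forall x : R, Jp x -> continuous alpha x)
  (Hbeta : forall y : R, Jm y -> continuous beta y)
  (HUp : is_frame Jp (eta_plus alpha) Up)
  (HUm : is_frame Jm (eta_minus beta) Um)
  (HL : is_birkhoff Jp Jm Up Um Lp Lm)
  (Hphi_hat : is_angle Jp Jm beta (Uhat Um Lp) phi_hat)
  (Hphi_tilde : forall x y : R, Jp x -> Jm y ->
     phi_tilde x y = phi_hat x y + alpha x)
  (Hphi_check : forall x y : R, Jp x -> Jm y ->
     phi_check x y = phi_tilde x y - alpha x - beta y) :
  C1M_on Jp Jm phi_check /\
  C0_on Jp Jm phi_tilde /\
  (forall x y : R, Jp x -> Jm y ->
     Dy (Dx phi_check) x y = sin (phi_check x y + alpha x + beta y) /\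
     Dx (Dy phi_check) x y = sin (phi_check x y + alpha x + beta y)) /\
  weak_xy Jp Jm phi_tilde (fun x y => sin (phi_tilde x y)) /\
  weak_yx Jp Jm phi_tilde (fun x y => sin (phi_tilde x y)).
Proof.
  destruct (angle_potential Jp Jm alpha beta Up Um Lp Lm phi_hat) as [w Hw]; auto.
  destruct Hphi_hat as [Hcont [Hbd _]].
  set (f := fun x y => phi_hat x y - beta y).
  set (g := fun x y => sin (phi_hat x y + alpha x)).
  assert (Ef : forall x y, Jp x -> Jm y -> phi_check x y = f x y).
  { intros x y Hx Hy. rewrite Hphi_check // Hphi_tilde //. unfold f; ring. }
  assert (Ca : C0_on Jp Jm (fun x _ => alpha x)) by (intros x y Hx Hy;
    now apply continuity_2d_pt_of_fst, Halpha).
  assert (Cb : C0_on Jp Jm (fun _ y => beta y)) by (intros x y Hx Hy;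
    now apply continuity_2d_pt_of_snd, Hbeta).
  assert (Cf : C0_on Jp Jm f).
  { intros x y Hx Hy. apply continuity_2d_pt_minus; auto. }
  assert (Ct : C0_on Jp Jm (fun x y => phi_hat x y + alpha x)).
  { intros x y Hx Hy. apply continuity_2d_pt_plus; auto. }
  assert (Cg : C0_on Jp Jm g).
  { intros x y Hx Hy. apply (continuity_1d_2d_pt_comp sin); [apply continuity_sin|now apply Ct]. }
  assert (Hext := fun h k => C0_on_ext Jp Jm h k HJp HJm).
  destruct (mixed_partials_commute Jp Jm f w g) as [Hv1 [Hv2 [Cw Cv]]]; auto.
  - intros; now apply Hw.
  - intros; now apply Hw.
  - intros; now apply Hw.
  - intros y Hy. unfold f. rewrite Hbd //. ring.
  - set (v := fun x y => RInt (fun s => g s y) 0 x) in *.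
    assert (Hfx : forall x y, Jp x -> Jm y -> is_derive (fun s => f s y) x (w x y)) by (intros;
      now apply Hw).
    assert (Cc : C0_on Jp Jm phi_check) by now apply Hext with f.
    destruct (C1M_of_mixed Jp Jm phi_check w v g) as [H1 H2]; auto.
    + intros x y Hx Hy. apply is_derive_ext_loc with (2 := Hfx x y Hx Hy).
      generalize (open_interval_locally _ _ HJp Hx). apply filter_imp. intros; symmetry; auto.
    + intros x y Hx Hy. apply is_derive_ext_loc with (2 := Hv1 x y Hx Hy).
      generalize (open_interval_locally _ _ HJm Hy). apply filter_imp. intros; symmetry; auto.
    + intros; now apply Hw.
    + assert (Eg : forall x y, Jp x -> Jm y -> g x y = sin (phi_tilde x y)).
      { intros x y Hx Hy. rewrite Hphi_tilde //. }
      assert (W : forall a b c d psi, test_function Jp Jm a b c d psi ->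
        integral_rect a b c d (fun x y => phi_tilde x y * Dy (Dx psi) x y)
        = integral_rect a b c d (fun x y => sin (phi_tilde x y) * psi x y)).
      { intros a b c d psi Hpsi. assert (W :=
          weak_of_mixed Jp Jm f v g alpha beta HJp HJm Hv1 Hv2 Cf Cv Cg Halpha Hbeta a b c d psi Hpsi).
        destruct Hpsi as [Hab [Hcd [Hap [Hcp _]]]].
        transitivity (integral_rect a b c d (fun x y => g x y * psi x y)); [rewrite -W|];
          apply integral_rect_ext; auto; intros x y Hx Hy.
        - rewrite Hphi_tilde; auto. unfold f. ring.
        - rewrite Eg; auto. }
      split; [exact H1|]. split; [now apply Hext with (2 := Ct)|].
      split; [|split].
      * intros x y Hx Hy. replace (phi_check x y + alpha x + beta y) with (phi_hat x y + alpha x);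
          [now apply H2|].
        rewrite Ef //. unfold f; ring.
      * intros a b c d psi Hpsi. rewrite -W //.
        destruct (test_function_facts _ _ _ _ _ _ _ Hpsi) as [_ [_ [_ [_ [_ [_ [_ [_ [S _]]]]]]]]].
        destruct Hpsi as [Hab [Hcd _]]. apply integral_rect_ext; auto. intros; now rewrite S.
      * exact W.
Qed.
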